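(* Let $\Omega$ be a nonempty open subset of $\mathbb{R}^N$ with finite measure and let $\omega$ be an admissible weight function in $\Omega$. If there exists a constant $k>0$ such that $k\le \omega(x,y)$ for all $(x,y)\in\Omega\times\Omega$, then $\mathrm{NLBV}_\omega(\Omega)\hookrightarrow \mathrm{BV}(\Omega)$. Moreover, the converse embedding $\mathrm{BV}(\Omega)\hookrightarrow \mathrm{NLBV}_\omega(\Omega)$ holds if and only if there exists a constant $K>0$ such that for all $x\in\Omega$ $$\int_\Omega \omega(x,y)\,\mathrm{d}y\le K.$$
   Context: An admissible weight function in $\Omega$ is a function $\omega:\Omega\times\Omega\to[0,+\infty)$ belonging to $\mathcal{C}^1(\Omega\times\Omega)$ with $\omega(x,y)=\omega(y,x)$ for all $(x,y)\in\Omega\times\Omega$ (no condition is imposed near the boundary of $\Omega\times\Omega$). For $\phi\in\mathcal{C}^1_c(\Omega\times\Omega;\mathbb{R}^N)$ the nonlocal divergence is $$\mathrm{div}_\omega(\phi)(x):=\int_\Omega \mathrm{div}_x\left[\omega(x,y)(\phi(y,x)-\phi(x,y))\right]\mathrm{d}y,\quad x\in\Omega .$$ For $u\in L^1(\Omega)$, $$\mathrm{NLTV}_\omega(u):=\sup\left\{\int_\Omega u(x)\,\mathrm{div}_\omega(\phi)(x)\,\mathrm{d}x:\ \phi\in\mathcal{C}^1_c(\Omega\times\Omega;\mathbb{R}^N),\ \|\phi\|_\infty\le1\right\}\in[0,+\infty],$$ where $\|\phi\|_\infty$ is the supremum of the pointwise Euclidean norm $|\phi|$. $\mathrm{NLBV}_\omega(\Omega):=\{u\in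 L^1(\Omega):\mathrm{NLTV}_\omega(u)<+\infty\}$ with norm $\|u\|_{L^1(\Omega)}+\mathrm{NLTV}_\omega(u)$. $\mathrm{BV}(\Omega)$ is the classical space of functions of bounded variation with norm $\|u\|_{L^1(\Omega)}+\mathrm{TV}(u)$, $\mathrm{TV}$ being the classical total variation in $\Omega$. $X\hookrightarrow Y$ means $X\subset Y$ and there is $C>0$ with $\|u\|_Y\le C\|u\|_X$ for all $u\in X$. *)

(* Defs.v *)
From HB Require Import structures.
From mathcomp Require Import all_boot all_order all_algebra.
From mathcomp Require Import all_classical all_reals all_analysis.
Set Implicit Arguments.
Unset Strict Implicit.
Unset Printing Implicit Defensive.
Import Order.TTheory GRing.Theory Num.Theory.
Import numFieldNormedType.Exports.
Local Open Scope classical_set_scope.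
Local Open Scope ring_scope.

(* The sigma-algebra on R^n generated by the coordinates, i.e. the product of
   the Borel sigma-algebras of the factors (the same construction as the
   library's one on n.-tuple R). *)
Section measurable_rV.
Context {R : realType} {n : nat}.

Definition rV_coord (i : 'I_n) (x : 'rV[R]_n) : measurableTypeR R := x ord0 i.

Let rV_set0 : g_sigma_preimage rV_coord set0.
Proof. exact: sigma_algebra0. Qed.

Let rV_setC A : g_sigma_preimage rV_coord A ->
  g_sigma_preimage rV_coord (~` A).
Proof. exact: sigma_algebraC. Qed.

Let rV_bigcup (F : (set 'rV[R]_n)^nat) :
  (forall i, g_sigma_preimage rV_coord (F i)) ->
  g_sigma_preimage rV_coord (\bigcup_i (F i)).
Proof. exact: sigma_algebra_bigcup. Qed.

HB.instance Definition _ := @isMeasurable.Build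
  (measure_tuple_display (sigma_display (@R.-ocitv.-measurable)))
  'rV[R]_n (g_sigma_preimage rV_coord) rV_set0 rV_setC rV_bigcup.

End measurable_rV.

Section lebesgue_measure_rV.
Context {R : realType}.

Lemma measurable_rV_coord n (i : 'I_n) :
  measurable_fun [set: 'rV[R]_n] (@rV_coord R n i).
Proof.
move=> _ Y mY; rewrite setTI; apply: sub_sigma_algebra => /=.
rewrite -bigcup_seq/=; exists i => /=; first by rewrite mem_index_enum.
by exists Y => //; rewrite setTI.
Qed.

Lemma measurable_fun_rVP d (T : measurableType d) n (f : T -> 'rV[R]_n) :
  (forall i, measurable_fun [set: T] (rV_coord i \o f)) ->
  measurable_fun [set: T] f.
Proof.
move=> mf.
suff : g_sigma_preimage (fun i => rV_coord i \o f) `<=` measurable.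
  rewrite g_sigma_preimage_comp => prefS _ A mA.
  by apply: prefS; exists A.
apply: smallest_sub; first exact: sigma_algebra_measurable.
case: n => [|n] in f mf *; first by rewrite big_ord0.
rewrite -bigcup_mkord_ord; apply: bigcup_sub => i Ii.
by move=> A [B mB <-]; exact: mf.
Qed.

Definition consrV n (p : measurableTypeR R * 'rV[R]_n) : 'rV[R]_n.+1 :=
  row_mx (const_mx p.1 : 'rV[R]_1) p.2.

Definition unconsrV n (x : 'rV[R]_n.+1) : measurableTypeR R * 'rV[R]_n :=
  (x ord0 ord0, \row_j x ord0 (lift ord0 j)).

Lemma consrV0 n (p : measurableTypeR R * 'rV[R]_n) : consrV p ord0 ord0 = p.1.
Proof. by rewrite mxE; case: splitP => // j _; rewrite mxE. Qed.

Lemma consrVS n (p : measurableTypeR R * 'rV[R]_n) j :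
  consrV p ord0 (lift ord0 j) = p.2 ord0 j.
Proof.
rewrite mxE; case: splitP => [k|k /= jk]; first by rewrite ord1.
by congr (p.2 _ _); apply: val_inj; move: jk => [].
Qed.

Lemma consrVK n : cancel (@consrV n) (@unconsrV n).
Proof.
move=> [a v]; rewrite /unconsrV consrV0; congr pair.
by apply/rowP => j; rewrite mxE consrVS.
Qed.

Lemma unconsrVK n : cancel (@unconsrV n) (@consrV n).
Proof.
move=> x; apply/rowP => i; case: (unliftP ord0 i) => [j|] ->.
  by rewrite consrVS mxE.
by rewrite consrV0.
Qed.

Lemma measurable_consrV n : measurable_fun setT (@consrV n).
Proof.
apply: measurable_fun_rVP => i; case: (unliftP ord0 i) => [j|] ->.
  rewrite (_ : _ \o _ = rV_coord j \o snd); last first.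
    by apply/funext => p; rewrite /= /rV_coord consrVS.
  by apply: measurableT_comp => //; exact: measurable_rV_coord.
rewrite (_ : _ \o _ = fst) //.
by apply/funext => p; rewrite /= /rV_coord consrV0.
Qed.

Lemma measurable_unconsrV n : measurable_fun setT (@unconsrV n).
Proof.
apply/measurable_fun_pairP; split.
  exact: (measurable_rV_coord ord0).
apply: measurable_fun_rVP => j.
rewrite (_ : _ \o _ = rV_coord (lift ord0 j)); first exact: measurable_rV_coord.
by apply/funext => x; rewrite /rV_coord /= mxE.
Qed.

Section consrV_measure.
Local Open Scope ereal_scope.
Variables (n : nat) (m : {sigma_finite_measure set 'rV[R]_n -> \bar R}).

Definition consrV_measure : set 'rV[R]_n.+1 -> \bar R :=
  pushforward (lebesgue_measure \x m) (@consrV n).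

Let preimage_measurable A : measurable A -> measurable (@consrV n @^-1` A).
Proof.
by move=> mA; rewrite -[X in measurable X]setTI; exact: measurable_consrV.
Qed.

Let consrV_measure0 : consrV_measure set0 = 0.
Proof. by rewrite /consrV_measure /pushforward preimage_set0 measure0. Qed.

Let consrV_measure_ge0 A : 0 <= consrV_measure A.
Proof. by rewrite /consrV_measure /pushforward measure_ge0. Qed.

Let consrV_measure_sigma_additive : semi_sigma_additive consrV_measure.
Proof.
move=> F mF tF mUF; rewrite /consrV_measure /pushforward preimage_bigcup.
apply: measure_semi_sigma_additive.
- by move=> k; exact: preimage_measurable.
- apply/trivIsetP => /= i j _ _ ij; rewrite -preimage_setI.
  by move/trivIsetP : tF => /(_ _ _ _ _ ij) ->//; rewrite preimage_set0.
- by rewrite -preimage_bigcup; exact: preimage_measurable.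
Qed.

HB.instance Definition _ := isMeasure.Build _ _ _ consrV_measure
  consrV_measure0 consrV_measure_ge0 consrV_measure_sigma_additive.

Let consrV_measure_sigma_finite : sigma_finite setT consrV_measure.
Proof.
have /sigma_finiteP[F [TF ndF Foo]] := sigma_finiteT (@lebesgue_measure R).
have /sigma_finiteP[G [TG ndG Goo]] := sigma_finiteT m.
exists (fun k => @unconsrV n @^-1` (F k `*` G k)).
  rewrite -preimage_bigcup (_ : \bigcup_k _ = setT) ?preimage_setT//.
  rewrite -subTset => -[x y] _.
  have [i _ Fix] : (\bigcup_i F i) x by rewrite -TF.
  have [j _ Gjy] : (\bigcup_j G j) y by rewrite -TG.
  exists (maxn i j) => //; split => /=.
  - by move: x Fix; exact/subsetPset/ndF/leq_maxl.
  - by move: y Gjy; exact/subsetPset/ndG/leq_maxr.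
move=> k; have [mF Fkoo] := Foo k; have [mG Gkoo] := Goo k; split.
  rewrite -[X in measurable X]setTI; apply: measurable_unconsrV => //.
  exact: measurableX.
rewrite /consrV_measure /pushforward -comp_preimage.
rewrite (_ : _ \o _ = id) ?preimage_id; last first.
  by apply/funext => p; exact: consrVK.
by rewrite product_measure1E// lte_mul_pinfty// ge0_fin_numE.
Qed.

HB.instance Definition _ := @Measure_isSigmaFinite.Build _ _ _ consrV_measure
  consrV_measure_sigma_finite.

End consrV_measure.

Section dirac_rV0.

Let dirac_sigma_finite :
  sigma_finite setT (dirac (0 : 'rV[R]_0) : set _ -> \bar R).
Proof.
by apply: fin_num_fun_sigma_finite => [|A _]; rewrite /= diracE ?ltry.
Qed.

Definition dirac_rV0 := @dirac _ 'rV[R]_0 0 R.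

HB.instance Definition _ := Measure.on dirac_rV0.
HB.instance Definition _ := @Measure_isSigmaFinite.Build _ _ _ dirac_rV0
  dirac_sigma_finite.

End dirac_rV0.

Fixpoint lebesgue_rV n : {sigma_finite_measure set 'rV[R]_n -> \bar R} :=
  match n with
  | 0 => dirac_rV0
  | n'.+1 => consrV_measure (lebesgue_rV n')
  end.

Lemma lebesgue_rV_box n (a b : 'rV[R]_n) :
  (forall i, a ord0 i <= b ord0 i) ->
  lebesgue_rV n (\bigcap_i [set x | a ord0 i <= x ord0 i <= b ord0 i]) =
  (\prod_(i < n) (b ord0 i - a ord0 i))%:E.
Proof.
elim: n a b => [|n IHn] a b ab.
  by rewrite big_ord0 /= /dirac_rV0 diracE mem_set// => -[].
pose a' := (unconsrV a).2; pose b' := (unconsrV b).2.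
pose B := \bigcap_i [set x : 'rV[R]_n | a' ord0 i <= x ord0 i <= b' ord0 i].
have mB : measurable B.
  apply: fin_bigcap_measurable => // i _.
  have mC : measurable (@rV_coord R n i @^-1` `[a' ord0 i, b' ord0 i]).
    rewrite -[X in measurable X]setTI.
    by apply: measurable_rV_coord => //; exact: measurable_itv.
  suff <- : @rV_coord R n i @^-1` `[a' ord0 i, b' ord0 i] =
    [set x : 'rV[R]_n | a' ord0 i <= x ord0 i <= b' ord0 i] by [].
  by apply/seteqP; split => x; rewrite /= /rV_coord in_itv.
have boxE : @consrV n @^-1`
    (\bigcap_i [set x | a ord0 i <= x ord0 i <= b ord0 i]) =
    `[a ord0 ord0, b ord0 ord0]%classic `*` B.
  apply/seteqP; split=> [p H|p [H0 HS] i _] /=.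
    split => [|i _]; first by have := H ord0 I; rewrite /= consrV0 in_itv.
    by have := H (lift ord0 i) I; rewrite /= consrVS !mxE.
  case: (unliftP ord0 i) => [j|] ->.
    by have := HS j I; rewrite /= consrVS !mxE.
  by rewrite consrV0; move: H0; rewrite /= in_itv.
rewrite [LHS](congr1 (lebesgue_measure \x lebesgue_rV n)%E boxE).
have mI : measurable (`[a ord0 ord0, b ord0 ord0]%classic :
    set (measurableTypeR R)) by exact: measurable_itv.
rewrite (product_measure1E lebesgue_measure (lebesgue_rV n) mI mB).
rewrite IHn => [|i]; last by rewrite !mxE.
rewrite big_ord_recl EFinM; congr (_ * _)%E; last first.
  by congr EFin; apply: eq_bigr => i _; rewrite !mxE.
transitivity (lebesgue_measure `[a ord0 ord0, b ord0 ord0]%classic) => //.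
rewrite lebesgue_measure_itv/= lte_fin.
by case: ltgtP (ab ord0) => // ->; rewrite subrr.
Qed.

End lebesgue_measure_rV.

Section function_spaces.
Context {R : realType}.

(* Differentiable at every point of U with a continuous differential; on the
   finite-dimensional spaces used below, continuity of all the directional
   derivatives is continuity of the differential. *)
Definition C1_on (V W : normedModType R) (U : set V) (f : V -> W) : Prop :=
  (forall x, U x -> differentiable f x) /\
  (forall v x, U x -> {for x, continuous ('D_v f)}).

Definition fun_support (V W : normedModType R) (f : V -> W) : set V :=
  closure [set x | f x != 0].

(* Elements of C^1_c(U; W) are represented by their extension by 0. *)
Definition C1_c (V W : normedModType R) (U : set V) : set (V -> W) :=
  [set f | [/\ C1_on U f, compact (fun_support f) & fun_support f `<=` U]].

(* The library's norm on 'rV[R]_N is the maximum norm. *)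
Definition eucl_norm N (v : 'rV[R]_N) : R :=
  Num.sqrt (\sum_(i < N) v ord0 i ^+ 2).

Definition sup_norm (V : Type) N (U : set V) (f : V -> 'rV[R]_N) : \bar R :=
  ereal_sup [set (eucl_norm (f x))%:E | x in U].

Definition divergence N (F : 'rV[R]_N -> 'rV[R]_N) (x : 'rV[R]_N) : R :=
  \sum_(i < N) 'D_(delta_mx ord0 i) (fun z => F z ord0 i) x.

Variable N : nat.
Implicit Types (Omega : set 'rV[R]_N) (w : 'rV[R]_N * 'rV[R]_N -> R)
  (u : 'rV[R]_N -> R).

Local Notation leb := (lebesgue_rV N : {measure set 'rV[R]_N -> \bar R}).

(* Only the values of w on Omega `*` Omega matter. *)
Definition admissible_weight Omega w : Prop :=
  [/\ forall x y, Omega x -> Omega y -> 0 <= w (x, y),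
      C1_on (Omega `*` Omega) w &
      forall x y, Omega x -> Omega y -> w (x, y) = w (y, x)].

Definition L1 Omega : set ('rV[R]_N -> R) :=
  [set u | leb.-integrable Omega (EFin \o u)].

Definition L1_norm Omega u : \bar R :=
  (\int[leb]_(x in Omega) `|u x|%:E)%E.

Definition div_w Omega w (phi : 'rV[R]_N * 'rV[R]_N -> 'rV[R]_N)
    (x : 'rV[R]_N) : R :=
  \int[leb]_(y in Omega)
    divergence (fun z => w (z, y) *: (phi (y, z) - phi (z, y))) x.

Definition NLTV Omega w u : \bar R :=
  ereal_sup [set (\int[leb]_(x in Omega) (u x * div_w Omega w phi x))%:E
    | phi in [set phi : 'rV[R]_N * 'rV[R]_N -> 'rV[R]_N |
        C1_c (Omega `*` Omega) phi /\
        (sup_norm (Omega `*` Omega) phi <= 1)%E]].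

Definition TV Omega u : \bar R :=
  ereal_sup [set (\int[leb]_(x in Omega) (u x * divergence phi x))%:E
    | phi in [set phi : 'rV[R]_N -> 'rV[R]_N |
        C1_c Omega phi /\ (sup_norm Omega phi <= 1)%E]].

Definition NLBV Omega w : set ('rV[R]_N -> R) :=
  [set u | L1 Omega u /\ (NLTV Omega w u < +oo)%E].

Definition NLBV_norm Omega w u : \bar R :=
  (L1_norm Omega u + NLTV Omega w u)%E.

Definition BV Omega : set ('rV[R]_N -> R) :=
  [set u | L1 Omega u /\ (TV Omega u < +oo)%E].

Definition BV_norm Omega u : \bar R := (L1_norm Omega u + TV Omega u)%E.

End function_spaces.

Definition embeds (R : realType) (T : Type) (X : set T) (normX : T -> \bar R)
    (Y : set T) (normY : T -> \bar R) : Prop :=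
  X `<=` Y /\
  exists2 C : R, 0 < C & forall u, X u -> (normY u <= C%:E * normX u)%E.

(* Main.v *)
From HB Require Import structures.
Require Import Defs.
From mathcomp Require Import all_boot all_order all_algebra.
From mathcomp Require Import all_classical all_reals all_analysis.
From mathcomp Require Import measurable_realfun lra.
Import Order.TTheory GRing.Theory Num.Theory.
Import numFieldNormedType.Exports.
Local Open Scope classical_set_scope.
Local Open Scope ring_scope.
Set Implicit Arguments.
Unset Strict Implicit.
Unset Printing Implicit Defensive.

(** The proof rests on one identity ([div_w_parametric]): by differentiation
    under the integral sign the nonlocal divergence of a test field [phi] is the
    ordinary divergence of the averaged field

      psi x = \int_y w (x, y) *: (phi (y, x) - phi (x, y)),

    which is again [C^1] with compact support in [Omega]. The nonlocal total
    variation is thus the supremum of the pairings of [u] with [div psi] over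
    the averaged fields [psi] only, and the three implications compare these
    fields with arbitrary ones.

    If the mass of [w (x, _)] is at most [K] for all [x], averaged fields have
    norm at most a multiple of [K], which bounds the nonlocal variation by the
    local one ([NLTV_le_TV]).

    If [k <= w], dividing by the weight produces averaged fields of the form
    [k *: (H *: psi x - eta x *: P)] for any prescribed [psi]. The error term
    involves only a fixed bump [eta] and a bounded vector [P], so its pairing
    with [u] is controlled by the norm of [u] in [L^1]; this bounds the local
    variation by the nonlocal one ([TV_le_NLTV]).

    Conversely, suppose that [BV] embeds into [NLBV] with constant [C]. A bound
    for the mass of the weight at a point is extracted by testing the embedding
    on functions that oscillate fast in one coordinate ([oscillation_test]).
    With [chi] a nonnegative bump and [l] large, [sin (l * x1) * chi / l] is
    small in [L^1] and has variation about the integral of [chi] times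
    [`|cos (l * x1)|]; paired with the field [cos (l * x1) * eta x * eta y] in
    the direction of [x1] it gives the integral of [sin (l * x1) ^ 2 * chi]
    against [\int_y w (x, y) * eta x * eta y], up to [O(1 / l)]. Adding the same
    estimate with sine and cosine exchanged removes the oscillating factor. In
    the limit the mean of this integral against any bump is at most [2 * C]
    ([mean_mass_bound]), hence so is its value at every point, and [eta] can be
    increased to 1 on [Omega] ([weight_mass_bound]). *)

(** * Continuously differentiable functions *)

Section C1_calculus.
Context {R : realType}.
Implicit Types V W : normedModType R.

(** The way to exhibit a differential by hand, for instance of an integral that
    depends on a parameter or of the squared positive part. *)
Lemma is_diff_approx V W (f L : V -> W) (x : V) : linear L -> continuous L ->
  (forall e : R, 0 < e ->
    \forall h \near (0 : V), `|f (h + x) - f x - L h| <= e * `|h|) ->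
  is_diff x f L.
Proof.
move=> linL cL Lf; pose LM := GRing.isLinear.Build _ _ _ _ L linL.
pose L' : {linear V -> W} := HB.pack L LM.
have fL : f \o shift x = cst (f x) + L' +o_ 0 id.
  apply/eqaddoE/eqaddoP => e e0; near=> h.
  rewrite /= !fctE opprD addrA; near: h; exact: Lf.
have dE : 'd f x = L' :> (V -> W) by exact: diff_unique.
by apply: DiffDef => //; apply/diff_locallyP; rewrite dE.
Unshelve. all: by end_near. Qed.

Lemma diff_approx V W (f : V -> W) (x : V) : differentiable f x ->
  forall e : R, 0 < e ->
    \forall h \near (0 : V), `|f (h + x) - f x - 'd f x h| <= e * `|h|.
Proof.
move=> /diff_locally/eqaddoP fL e e0; near=> h.
have : `|(f \o shift x - (cst (f x) + 'd f x)) h| <= e * `|h|.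
  by near: h; exact: fL.
by rewrite /= !fctE opprD addrA.
Unshelve. all: by end_near. Qed.

Lemma C1_on_sub V W (U U' : set V) (f : V -> W) :
  U `<=` U' -> C1_on U' f -> C1_on U f.
Proof. by move=> UU' [df cf]; split=> [x /UU'/df|v x /UU'/cf]. Qed.

Lemma C1_on_setU V W (U U' : set V) (f : V -> W) :
  C1_on U f -> C1_on U' f -> C1_on (U `|` U') f.
Proof.
move=> [df cf] [df' cf']; split=> [x [/df|/df']//|v x [/cf|/cf']//]; exact.
Qed.

Lemma C1_on_eq V W (U : set V) (f g : V -> W) :
  open U -> (forall x, U x -> f x = g x) -> C1_on U f -> C1_on U g.
Proof.
move=> oU fg [df cf].
have nearfg x : U x -> {near x, f =1 g}.
  by move=> Ux; apply: filterS (open_nbhs_nbhs (conj oU Ux)) => z /fg.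
have dg v x : U x -> 'D_v g x = 'D_v f x.
  by move=> Ux; apply/esym/near_eq_derive; exact: nearfg.
split=> [x Ux|v x Ux].
  have h := df x Ux.
  suff [] : is_diff x g ('d f x) by [].
  apply: is_diff_approx; [exact: linearP|exact: diff_continuous|].
  move=> e e0; near=> z.
  rewrite -(fg x)// -(fg (z + x)); first by near: z; exact: diff_approx.
  near: z.
  have : \forall z \near x, U z by exact: open_nbhs_nbhs.
  by rewrite (near_shift 0)/= subr0.
have /near_eq_cvg h : {near x, 'D_v f =1 'D_v g}.
  by apply: filterS (open_nbhs_nbhs (conj oU Ux)) => z Uz; rewrite dg.
rewrite /prop_for /continuous_at dg//.
exact: cvg_trans h (cf v x Ux).
Unshelve. all: by end_near. Qed.

Lemma C1_on_cst V W (U : set V) (a : W) : C1_on U (cst a : V -> W).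
Proof.
split=> [x _|v x _]; first exact: differentiable_cst.
rewrite (_ : 'D_v _ = cst 0); first exact: cst_continuous.
by apply/funext => z; rewrite derive_cst.
Qed.

Lemma C1_on_continuous V W (U : set V) (f : V -> W) x :
  C1_on U f -> U x -> {for x, continuous f}.
Proof. by move=> [df _] /df; exact: differentiable_continuous. Qed.

(** A formula for the directional derivatives need only hold on the open set:
    continuity at a point of it is a local property. *)
Lemma C1_onI V W (U : set V) (f : V -> W) (df : V -> V -> W) : open U ->
  (forall x, U x -> differentiable f x) ->
  (forall v x, U x -> 'D_v f x = df v x) ->
  (forall v x, U x -> {for x, continuous (df v)}) -> C1_on U f.
Proof.
move=> oU dif fE cf; split=> // v x Ux.
have /near_eq_cvg h : {near x, df v =1 'D_v f}.
  by apply: filterS (open_nbhs_nbhs (conj oU Ux)) => z Uz; rewrite fE.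
rewrite /prop_for /continuous_at fE//.
exact: cvg_trans h (cf v x Ux).
Qed.

Lemma C1_onD V W (U : set V) (f g : V -> W) : open U ->
  C1_on U f -> C1_on U g -> C1_on U (fun x => f x + g x).
Proof.
move=> oU [df cf] [dg cg].
apply: (C1_onI oU (df := fun v x => 'D_v f x + 'D_v g x)).
- by move=> x Ux; apply: differentiableD; [exact: df|exact: dg].
- move=> v x Ux; rewrite -[LHS]/('D_v (f + g) x) deriveD//.
    by apply: diff_derivable; exact: df.
  by apply: diff_derivable; exact: dg.
- by move=> v x Ux; apply: continuousD; [exact: cf|exact: cg].
Qed.

Lemma C1_onN V W (U : set V) (f : V -> W) : open U ->
  C1_on U f -> C1_on U (fun x => - f x).
Proof.
move=> oU [df cf].
apply: (C1_onI oU (df := fun v x => - 'D_v f x)).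
- by move=> x Ux; apply: differentiableN; exact: df.
- move=> v x Ux; rewrite -[LHS]/('D_v (- f) x) deriveN//.
  by apply: diff_derivable; exact: df.
- by move=> v x Ux; apply: continuousN; exact: cf.
Qed.

Lemma C1_onM V (U : set V) (f g : V -> R) : open U ->
  C1_on U f -> C1_on U g -> C1_on U (fun x => f x * g x).
Proof.
move=> oU C1f C1g; have [df cf] := C1f; have [dg cg] := C1g.
apply: (C1_onI oU (df := fun v x => f x * 'D_v g x + g x * 'D_v f x)).
- by move=> x Ux; apply: differentiableM; [exact: df|exact: dg].
- move=> v x Ux; rewrite -[LHS]/('D_v (f * g) x) deriveM//.
    by apply: diff_derivable; exact: df.
  by apply: diff_derivable; exact: dg.
- move=> v x Ux; apply: (@continuousD R R^o V).
    apply: (@continuousM R V); [exact: (C1_on_continuous C1f)|exact: cg].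
  apply: (@continuousM R V); [exact: (C1_on_continuous C1g)|exact: cf].
Qed.

Lemma C1_onV V (U : set V) (f : V -> R) : open U ->
  (forall x, U x -> f x != 0) ->
  C1_on U f -> C1_on U (fun x => (f x)^-1).
Proof.
move=> oU f0 C1f; have [df cf] := C1f.
apply: (C1_onI oU (df := fun v x => - (f x)^-2 * 'D_v f x)).
- by move=> x Ux; apply: differentiableV; [exact: df|exact: f0].
- move=> v x Ux; rewrite deriveV//; first exact: f0.
  by apply: diff_derivable; exact: df.
- move=> v x Ux; apply: (@continuousM R V); last exact: cf.
  apply: (@continuousN R R^o V); apply: (@continuousV R V).
    by rewrite expf_neq0 ?f0.
  apply: (@continuousM R V); exact: (C1_on_continuous C1f).
Qed.

Lemma derive_mul V (f g : V -> R) (v x : V) :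
  differentiable f x -> differentiable g x ->
  'D_v (fun z => f z * g z) x = f x * 'D_v g x + g x * 'D_v f x.
Proof.
move=> df dg; rewrite -[LHS]/('D_v (f * g) x) deriveM//; exact: diff_derivable.
Qed.

Lemma derive_add (V : normedModType R) (f g : V -> R) (v x : V) :
  differentiable f x -> differentiable g x ->
  'D_v (fun z => f z + g z) x = 'D_v f x + 'D_v g x.
Proof.
move=> df dg; rewrite -[LHS]/('D_v (f + g) x) deriveD//; exact: diff_derivable.
Qed.

Lemma derive_scale (V : normedModType R) (a : R) (f : V -> R) (v x : V) :
  differentiable f x -> 'D_v (fun z => a * f z) x = a * 'D_v f x.
Proof.
move=> df; rewrite (@derive_mul _ (cst a))//.
by rewrite derive_cst mulr0 addr0.
Qed.

Lemma derive_comp_diff (V V' W : normedModType R) (f : V -> W) (g : V' -> V)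
    (L : V' -> V) (x v : V') :
  is_diff x g L -> differentiable f (g x) ->
  differentiable (f \o g) x /\ 'D_v (f \o g) x = 'D_(L v) f (g x).
Proof.
move=> [dg dgL] df.
have dfg : differentiable (f \o g) x by exact: differentiable_comp.
by split=> //; rewrite !deriveE// diff_comp//= dgL.
Qed.

(** An affine map has the same differential [L] everywhere, so the directional
    derivatives of [f \o g] are those of [f] in the fixed directions [L v],
    which are continuous by hypothesis. *)
Lemma C1_on_comp_affine (V V' W : normedModType R) (U : set V) (f : V -> W)
    (g : V' -> V) (L : V' -> V) :
  (forall x, is_diff x g L) -> open U ->
  C1_on U f -> C1_on (g @^-1` U) (f \o g).
Proof.
move=> dg oU [df cf].
have cg : continuous g.
  by move=> x; apply: differentiable_continuous; have [] := dg x.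
apply: (C1_onI (df := fun v x => 'D_(L v) f (g x))).
- by apply: open_comp => // x _; exact: cg.
- by move=> x Ux; have [] := derive_comp_diff 0 (dg x) (df _ Ux).
- by move=> v x Ux; have [] := derive_comp_diff v (dg x) (df _ Ux).
- by move=> v x Ux; apply: (@continuous_comp _ _ _ g ('D_(L v) f));
  [exact: cg|exact: cf].
Qed.

Lemma derive_comp_real V (h : R -> R) (f : V -> R) (v x : V) :
  derivable h (f x) 1 -> differentiable f x ->
  differentiable (h \o f) x /\ 'D_v (h \o f) x = (derive1 h) (f x) * 'D_v f x.
Proof.
move=> dh df; have dh' : differentiable h (f x) by apply/derivable1_diffP.
have dhf : differentiable (h \o f) x by exact: differentiable_comp.
split=> //; rewrite (deriveE _ dhf) (deriveE _ df) diff_comp//= diff1E//.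
by rewrite mulrC.
Qed.

Lemma C1_on_comp_real V (U : set V) (h : R -> R) (f : V -> R) : open U ->
  (forall t, derivable h t 1) -> continuous (derive1 h) ->
  C1_on U f -> C1_on U (h \o f).
Proof.
move=> oU dh ch C1f; have [df cf] := C1f.
apply: (C1_onI oU (df := fun v x => (derive1 h) (f x) * 'D_v f x)).
- by move=> x Ux; have [] := derive_comp_real 0 (dh (f x)) (df _ Ux).
- by move=> v x Ux; have [] := derive_comp_real v (dh (f x)) (df _ Ux).
- move=> v x Ux; apply: (@continuousM R V); last exact: cf.
  apply: (@continuous_comp _ _ _ f (derive1 h)); last exact: ch.
  exact: (C1_on_continuous C1f).
Qed.

Lemma is_diff_linear V W (f : V -> W) (x : V) :
  linear f -> continuous f -> is_diff x f f.
Proof.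
move=> linf cf; apply: is_diff_approx => // e e0; near=> h.
have -> : f (h + x) = f h + f x by rewrite -[h]scale1r linf !scale1r.
by rewrite addrK subrr normr0 mulr_ge0// ltW.
Unshelve. all: by end_near. Qed.

Lemma is_diff_fst V W (z : V * W) : is_diff z fst fst.
Proof. by apply: is_diff_linear => // y; exact: cvg_fst. Qed.

Lemma is_diff_snd V W (z : V * W) : is_diff z snd snd.
Proof. by apply: is_diff_linear => // y; exact: cvg_snd. Qed.

Lemma is_diff_swap V W (z : V * W) :
  is_diff z (fun z => (z.2, z.1)) (fun z => (z.2, z.1)).
Proof. by apply: is_diff_pair; [exact: is_diff_snd|exact: is_diff_fst]. Qed.

Lemma is_diff_pairl (V W : normedModType R) (y : W) (x : V) :
  is_diff x (fun z => (z, y)) (fun v => (v, 0)).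
Proof.
have : is_diff x (fun z => (id z, cst y z)) (fun v => (id v, (0 : V -> W) v)).
  by apply: is_diff_pair.
by [].
Qed.

Lemma is_diff_coord n (i : 'I_n) (x : 'rV[R]_n) :
  is_diff x (fun z : 'rV[R]_n => z ord0 i) (fun z : 'rV[R]_n => z ord0 i).
Proof.
apply: is_diff_linear; last exact: coord_continuous.
by move=> a u v; rewrite !mxE.
Qed.

Lemma derive_coord n (i : 'I_n) (v x : 'rV[R]_n) :
  'D_v (fun z : 'rV[R]_n => z ord0 i) x = v ord0 i.
Proof. by have [d dE] := is_diff_coord i x; rewrite deriveE// dE. Qed.

Lemma C1_on_coord n (U : set 'rV[R]_n) i : open U ->
  C1_on U (fun x : 'rV[R]_n => x ord0 i).
Proof.
move=> oU; apply: (@C1_onI _ _ U _ (fun v _ : 'rV[R]_n => v ord0 i)) => //.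
- by move=> x _; exact: differentiable_coord.
- by move=> v x _; exact: derive_coord.
- by move=> v x _; exact: cst_continuous.
Qed.

Lemma continuous_rV (T : topologicalType) n (F : T -> 'rV[R]_n) (x : T) :
  (forall i, {for x, continuous (fun z => F z ord0 i)}) ->
  {for x, continuous F}.
Proof.
move=> cF; apply/cvg_mx_entourageP => A eA.
have H j : \forall z \near x, A (F x ord0 j, F z ord0 j).
  have /cvg_app_entourageP/(_ _ eA) h := cF j.
  by apply: filterS h => z /=.
rewrite near_simpl; near=> z => i j; rewrite inE ord1 => {i}.
by move: j; near: z; exact: filter_forall H.
Unshelve. all: by end_near. Qed.

Lemma is_diff_rV V n (F : V -> 'rV[R]_n) (L : 'I_n -> V -> R) (x : V) :
  (forall i, is_diff x (fun z => F z ord0 i) (L i)) ->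
  is_diff x F (fun v => \row_i L i v).
Proof.
move=> dFi.
have dF : differentiable F x.
  have -> : F = \sum_(i < n) (fun x => F x ord0 i *: delta_mx ord0 i).
    by apply/funext => z; rewrite [LHS]row_sum_delta fct_sumE.
  apply: differentiable_sum => i; apply: differentiableZl.
  by have [] := dFi i.
apply: DiffDef => //; apply/funext => v.
rewrite -deriveE// derive_mx; last exact: diff_derivable.
apply/rowP => j; rewrite !mxE.
by have [d dE] := dFi j; rewrite deriveE// dE.
Qed.

Lemma C1_on_rVP V n (U : set V) (F : V -> 'rV[R]_n) : open U ->
  C1_on U F <-> forall i, C1_on U (fun x => F x ord0 i).
Proof.
move=> oU; split=> [[dF cF] i|C1F].
  apply: (C1_onI oU (df := fun v x => ('D_v F x) ord0 i)).
  - move=> x Ux; rewrite -[X in differentiable X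
    _]/((fun M : 'rV[R]_n => M ord0 i) \o F).
    by apply: differentiable_comp; [exact: dF|exact: differentiable_coord].
  - by move=> v x Ux; rewrite derive_mx ?mxE//; exact: diff_derivable (dF _ Ux).
  - move=> v x Ux.
    apply: (@continuous_comp _ _ _ ('D_v F) (fun M : 'rV[R]_n => M ord0 i)).
      exact: cF.
    exact: coord_continuous.
have dF x : U x -> differentiable F x.
  move=> Ux; suff [] : is_diff x F
    (fun v => \row_i 'd (fun z => F z ord0 i) x v) by [].
  apply: is_diff_rV => i; apply: DiffDef => //.
  by have [+ _] := C1F i; exact.
apply: (C1_onI oU (df := fun v x => \row_i 'D_v (fun x => F x ord0 i) x)) => //.
- move=> v x Ux; rewrite derive_mx; last exact/diff_derivable/dF.
  by apply/matrixP => i j; rewrite !mxE ord1.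
- move=> v x Ux; apply: continuous_rV => i.
  rewrite (_ : (fun z => _) = 'D_v (fun x => F x ord0 i)).
    by have [_ +] := C1F i; exact.
  by apply/funext => z; rewrite mxE.
Qed.

Lemma compact_continuous_bounded (T : topologicalType) (K : set T)
    (f : T -> R) : compact K -> (forall x, K x -> {for x, continuous f}) ->
  exists2 C, 0 < C & forall x, K x -> `|f x| <= C.
Proof.
move=> cK cf; have : compact (f @` K).
  apply: continuous_compact => //; apply: continuous_in_subspaceT => x /set_mem.
  exact: cf.
move=> /compact_bounded/ex_strict_bound_gt0[C C0 CK]; exists C => // x Kx.
by apply/ltW/CK; exists x.
Qed.

(** The complement of a closed set is open, so a function vanishing there is
    locally zero. *)
Lemma derive_off_closed V W (K : set V) (f : V -> W) (v x : V) : closed K ->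
  (forall z, ~ K z -> f z = 0) -> ~ K x -> 'D_v f x = 0.
Proof.
move=> cK f0 Kx; rewrite -(derive_cst (0 : W) x v).
apply: near_eq_derive.
have : \forall z \near x, (~` K) z.
  by apply: open_nbhs_nbhs; split=> //; exact: closed_openC.
by apply: filterS => z /f0.
Qed.

End C1_calculus.

(** * Cubes, and Borel sets of the product sigma-algebra *)

Section measurability.
Context {R : realType} {n : nat}.
Implicit Types (U : set 'rV[R]_n) (f : 'rV[R]_n -> R).

Lemma ball_rVE (c x : 'rV[R]_n) (r : R) : 0 < r ->
  ball c r x <-> forall i, `|c ord0 i - x ord0 i| < r.
Proof.
move=> r0; split=> [[_ h] i|h]; first exact: h.
by split=> // i j; rewrite ord1; exact: h.
Qed.

Lemma measurable_ball_rV (c : 'rV[R]_n) (r : R) : 0 < r ->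
  measurable (ball c r : set 'rV[R]_n).
Proof.
move=> r0.
have -> : ball c r = \bigcap_i (rV_coord i @^-1` (ball (c ord0 i) r)).
  apply/seteqP; split=> x; first by move=> /(ball_rVE _ _ r0) h i _; exact: h.
  by move=> h; apply/(ball_rVE _ _ r0) => i; exact: h.
apply: fin_bigcap_measurable => // i _; rewrite -[X in measurable X]setTI.
by apply: measurable_rV_coord => //; apply: open_measurable; exact: ball_open.
Qed.

Lemma coord_le_norm (x : 'rV[R]_n) i : `|x ord0 i| <= `|x|.
Proof.
rewrite [leRHS]/Num.Def.normr/= mx_normrE.
exact: (le_bigmax _ (fun p : 'I_1 * 'I_n => `|x p.1 p.2|) (ord0, i)).
Qed.

Definition cube (c : 'rV[R]_n) (r : R) : set 'rV[R]_n :=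
  [set x | forall i, `|x ord0 i - c ord0 i| <= r].

Lemma cube0P (r : R) (x : 'rV[R]_n) :
  cube 0 r x <-> forall i, `|x ord0 i| <= r.
Proof. by split=> h i; have := h i; rewrite mxE subr0. Qed.

Lemma ball_sub_cube c r : ball c r `<=` cube c r.
Proof. by move=> x [_ h] i; rewrite distrC; exact/ltW/h. Qed.

Lemma cube_sub_ball c r s : 0 < s -> r < s -> cube c r `<=` ball c s.
Proof.
move=> s0 rs x cx; apply/ball_rVE => // i.
by rewrite distrC (le_lt_trans (cx i)).
Qed.

Lemma compact_cube c r : compact (cube c r).
Proof.
rewrite (_ : cube c r = [set v : 'rV[R]_n |
    forall i, `[c ord0 i - r, c ord0 i + r]%classic (v ord0 i)]).
  apply: (@rV_compact _ _ (fun i => `[c ord0 i - r, c ord0 i + r]%classic)) =>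
    i.
  exact: segment_compact.
by apply/seteqP; split=> x h i; have := h i; rewrite /= in_itv/= ler_distl.
Qed.

Lemma compact_sub_cube (K : set 'rV[R]_n) : compact K ->
  exists2 r, 0 <= r & K `<=` cube 0 r.
Proof.
move=> cK; have [C C0 hC] := compact_continuous_bounded cK
  (fun x _ => @norm_continuous R _ x).
exists C; first exact: ltW.
move=> x /hC; rewrite normr_id => xC; apply/cube0P => i.
exact: le_trans (coord_le_norm _ _) xC.
Qed.

Lemma cubeE c r : cube c r =
  \bigcap_i [set x | (c - const_mx r) ord0 i <= x ord0 i <= (c + const_mx r)
    ord0 i].
Proof.
by apply/seteqP; split=> x h i; [move=> _; have := h i|have := h i I];
  rewrite /= !mxE ler_distl.
Qed.

Lemma measurable_cube c r : measurable (cube c r).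
Proof.
rewrite (_ : cube c r =
    \bigcap_i (@rV_coord R n i @^-1` `[c ord0 i - r, c ord0 i + r])).
  apply: fin_bigcap_measurable => // i _; rewrite -[X in measurable X]setTI.
  by apply: measurable_rV_coord => //; exact: measurable_itv.
by apply/seteqP; split=> x h i; [move=> _; have := h i|have := h i I];
  rewrite /= /rV_coord in_itv/= ler_distl.
Qed.

Lemma lebesgue_cube_lty c r : 0 <= r -> (lebesgue_rV n (cube c r) < +oo)%E.
Proof.
by move=> r0; rewrite cubeE lebesgue_rV_box ?ltry// => i; rewrite !mxE; lra.
Qed.

Lemma lebesgue_cube_gt0 c r : 0 < r -> (0 < lebesgue_rV n (cube c r))%E.
Proof.
move=> r0; rewrite cubeE lebesgue_rV_box => [|i]; last by rewrite !mxE; lra.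
by rewrite lte_fin; apply: prodr_gt0 => i _; rewrite !mxE; lra.
Qed.

(** Countably many balls suffice to describe an open set. The factor 2 leaves
    room for the closed cube of the same radius inside the open set, which is
    what a compactly supported bump needs. *)
Lemma open_rat_ball U (x : 'rV[R]_n) : open U -> U x ->
  exists (q : 'rV[rat]_n) (k : nat),
    ball (map_mx ratr q : 'rV[R]_n) k.+1%:R^-1 x /\
    ball (map_mx ratr q : 'rV[R]_n) (k.+1%:R^-1 *+ 2) `<=` U.
Proof.
move=> oU Ux; have /nbhs_ballP[e /= e0 eU] : nbhs x U by exact: open_nbhs_nbhs.
have [k ke] : exists k : nat, k.+1%:R^-1 < e / 3.
  have := @near_infty_natSinv_lt R (PosNum (divr_gt0 e0 (ltr0n _ 3))).
  by move=> [k _ /(_ k (leqnn k))] /= ?; exists k.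
have k0 : 0 < k.+1%:R^-1 :> R by rewrite invr_gt0.
have /choice[q hq] : forall i, exists q : rat,
    ratr q \in `]x ord0 i - k.+1%:R^-1, x ord0 i + k.+1%:R^-1[.
  by move=> i; apply: rat_in_itvoo; rewrite ltrD2l gtrN.
have qx : ball (map_mx ratr (\row_i q i) : 'rV[R]_n) k.+1%:R^-1 x.
  apply/(ball_rVE _ _ k0) => i; rewrite !mxE.
  by have := hq i; rewrite in_itv/= ltr_distl => /andP[-> ->].
exists (\row_i q i), k; split=> // y qy; apply: eU.
have := ball_triangle (ball_sym qx) qy; apply: le_ball.
by move: ke; rewrite mulr2n; move: (k.+1%:R^-1) => d; lra.
Qed.

(** The sigma-algebra is generated by the coordinates, so balls of the maximum
    norm, being boxes, are measurable; an open set is a countable union of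
    rational ones. *)
Lemma open_measurable_rV U : open U -> measurable U.
Proof.
move=> oU.
have -> : U = \bigcup_(p in [set p : 'rV[rat]_n * nat |
    ball (map_mx ratr p.1 : 'rV[R]_n) p.2.+1%:R^-1 `<=` U])
    ball (map_mx ratr p.1 : 'rV[R]_n) p.2.+1%:R^-1.
  apply/seteqP; split=> x; last by move=> [p /= pU] /pU.
  move=> Ux; have [q [k [qx qU]]] := open_rat_ball oU Ux.
  exists (q, k) => //=; apply: subset_trans qU; apply: le_ball.
  by rewrite mulr2n lerDl invr_ge0.
rewrite bigcup_mkcond; apply: countable_bigcupT_measurable => // p.
case: ifPn => // _.
by apply: measurable_ball_rV; rewrite invr_gt0.
Qed.

Lemma open_continuous_measurable_fun_rV U f : open U ->
  (forall x, U x -> {for x, continuous f}) -> measurable_fun U f.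
Proof.
move=> oU cf; apply: (measurability _ (RGenOInfty.measurableE R)).
move=> _ [_ [a ->] <-]; apply: open_measurable_rV.
rewrite openE => x [Ux /=]; rewrite in_itv/= andbT => ax.
have : \forall y \near x, a < f y by exact: (cvgr_gt _ (cf x Ux) _ ax).
have : \forall y \near x, U y by exact: open_nbhs_nbhs.
apply: filterS2 => y Uy ay; split=> //=; by rewrite in_itv/= andbT.
Qed.

End measurability.

(** * The integral of a partial derivative *)

Section iterated_integrals.
Context {R : realType}.

Lemma integrable_cube n (M : R) (h : 'rV[R]_n -> R) : 0 <= M ->
  continuous h -> (forall x, ~ cube 0 M x -> h x = 0) ->
  (lebesgue_rV n).-integrable setT (EFin \o h).
Proof.
move=> M0 ch h0.
have [C C0 hC] : exists2 C, 0 < C & forall x, cube 0 M x -> `|h x| <= C.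
  by apply: compact_continuous_bounded; [exact: compact_cube|move=> x _;
    exact: ch].
have mh : measurable_fun setT h.
  by apply: open_continuous_measurable_fun_rV => [|x _];
    [exact: openT|exact: ch].
have -> : EFin \o h = (EFin \o h) \_ (cube (0 : 'rV[R]_n) M).
  apply/funext => x; rewrite patchE; case: ifPn => // /negP xM /=.
  by rewrite h0// => xb; apply: xM; rewrite inE.
have mb := measurable_cube (0 : 'rV[R]_n) M;
  apply: (iffLR (integrable_mkcond _ mb)).
apply: (@measurable_bounded_integrable _ _ _ (lebesgue_rV n) h
  (cube (0 : 'rV[R]_n) M)
  mb).
- exact: lebesgue_cube_lty.
- exact: measurable_funTS.
by exists C; split; [exact: num_real|move=> D CD x /hC hx;
  apply: le_trans hx (ltW CD)].
Qed.

(** The measure in dimension [n.+1] is by construction the image of a product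
    measure; this is the form in which Fubini can be applied to it. *)
Lemma integrable_cube_prod n (M : R) (h : 'rV[R]_n.+1 -> R) : 0 <= M ->
  continuous h -> (forall x, ~ cube 0 M x -> h x = 0) ->
  (lebesgue_measure \x lebesgue_rV n)%E.-integrable setT
     (EFin \o (h \o @consrV R n)) /\
  (\int[lebesgue_rV n.+1]_x (h x)%:E =
   \int[lebesgue_measure \x lebesgue_rV n]_p (h (consrV p))%:E)%E.
Proof.
move=> M0 ch h0.
have mh : measurable_fun setT h.
  by apply: open_continuous_measurable_fun_rV => [|x _];
    [exact: openT|exact: ch].
have mhe : measurable_fun setT (EFin \o h) by exact/measurable_EFinP.
have /integrableP[_ hoo] := integrable_cube M0 ch h0.
have ip : (lebesgue_measure \x lebesgue_rV n)%E.-integrable setT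
     (EFin \o (h \o @consrV R n)).
  apply/integrableP; split.
    apply/measurable_EFinP; apply: measurableT_comp => //.
    exact: measurable_consrV.
  move: hoo; apply: le_lt_trans.
  rewrite [leRHS](ge0_integral_pushforward (@measurable_consrV R n))//=.
  have ma : measurable_fun setT (abse \o (EFin \o h))
    by apply: measurableT_comp mhe.
  exact: ma.
split=> //.
exact: (integral_pushforward (@measurable_consrV R n) mhe ip).
Qed.

(** The fundamental theorem of calculus on an interval slightly larger than the
    support. *)
Lemma integral_derive_eq0 (F f : R -> R) (M : R) : 0 <= M ->
  (forall t : R, is_derive t (1 : R) F (f t)) -> continuous f ->
  (forall t, M < `|t| -> F t = 0 /\ f t = 0) ->
  (\int[lebesgue_measure]_t (f t)%:E = 0)%E.
Proof.
move=> M0 dF cf F0.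
have dF1 t : derivable F t 1 by have [] := dF t.
have cF : continuous F.
  by move=> t; apply: differentiable_continuous; apply/derivable1_diffP.
transitivity (\int[lebesgue_measure]_(t in `[(- (M + 1))%R, (M + 1)%R])
  (f t)%:E)%E.
  rewrite [RHS]integral_mkcond; apply: eq_integral => t _.
  rewrite patchE; case: ifPn => // /negP tM.
  suff /F0[_ ->//] : M < `|t|.
  rewrite ltNge; apply/negP => tM'; apply: tM; rewrite inE/= in_itv/=.
  by rewrite -ler_norml; lra.
rewrite (@continuous_FTC2 _ f F)//.
- have M1 : M < `|M + 1| by rewrite ger0_norm; lra.
  have [-> _] := F0 _ M1; rewrite -normrN in M1.
  by have [-> _] := F0 _ M1; rewrite subee.
- by lra.
- exact: continuous_subspaceT.
- split.
  + by move=> t _; exact: dF1.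
  + exact: cvg_at_right_filter (cF _).
  + exact: cvg_at_left_filter (cF _).
- by move=> t _; rewrite derive1E derive_val.
Qed.

Lemma is_diff_consrV1 n (t : R) (y : 'rV[R]_n) :
  is_diff t (fun t : R => consrV (t, y)) (fun s => s *: delta_mx ord0 ord0).
Proof.
have : is_diff t (fun t : R => consrV (t, y))
    (fun s => \row_i (if unlift ord0 i is Some j then 0 else s)).
  apply: is_diff_rV => i; case: (unliftP ord0 i) => [j|] ->.
    rewrite (_ : (fun z => _) = cst (y ord0 j)).
      apply: DiffDef => //; exact: diff_cst.
    by apply/funext => z; rewrite consrVS.
  rewrite (_ : (fun z => _) = id); first exact: is_diff_id.
  by apply/funext => z; rewrite consrV0.
congr is_diff_def; apply/funext => s; apply/rowP => i; rewrite !mxE eqxx.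
case: (unliftP ord0 i) => [j|] ->; first by rewrite mulr0.
by rewrite mulr1.
Qed.

Lemma is_diff_consrV2 n (t : R) (y : 'rV[R]_n) :
  is_diff y (fun y : 'rV[R]_n => consrV (t, y)) (fun z => consrV (0, z)).
Proof.
have : is_diff y (fun y : 'rV[R]_n => consrV (t, y))
    (fun z => \row_i (if unlift ord0 i is Some j then z ord0 j else 0)).
  apply: is_diff_rV => i; case: (unliftP ord0 i) => [j|] ->.
    rewrite (_ : (fun z => _) = fun z : 'rV[R]_n => z ord0 j).
      exact: is_diff_coord.
    by apply/funext => z; rewrite consrVS.
  rewrite (_ : (fun z => _) = cst t).
    apply: DiffDef => //; exact: diff_cst.
  by apply/funext => z; rewrite consrV0.
congr is_diff_def; apply/funext => s; apply/rowP => i; rewrite [LHS]mxE.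
by case: (unliftP ord0 i) => [j|] ->; rewrite ?consrVS ?consrV0.
Qed.

Lemma consrV_delta n (j : 'I_n) :
  consrV (0 : R, delta_mx ord0 j) = delta_mx ord0 (lift ord0 j).
Proof.
apply/rowP => i; case: (unliftP ord0 i) => [k|] ->.
  by rewrite consrVS !mxE.
by rewrite consrV0 mxE.
Qed.

(** By induction on the dimension. For the first coordinate, integrate along it
    first and use the one-dimensional case; for any other one, integrate first
    over the remaining coordinates and use the induction hypothesis. *)
Lemma integral_partial_eq0 n (M : R) (g : 'rV[R]_n -> R) (i : 'I_n) :
  0 <= M -> C1_on setT g -> (forall x, ~ cube 0 M x -> g x = 0) ->
  (\int[lebesgue_rV n]_x ('D_(delta_mx ord0 i) g x)%:E = 0)%E.
Proof.
move=> M0; elim: n => [|n IHn] in g i *; first by case: i.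
move=> C1g g0; have [dg cdg] := C1g.
have cdgT v : continuous ('D_v g) by move=> x; exact: cdg.
have dg0 v x : ~ cube 0 M x -> 'D_v g x = 0.
  apply: derive_off_closed g0; apply: compact_closed; last exact: compact_cube.
  exact: norm_hausdorff.
have [ip ->] := integrable_cube_prod M0 (cdgT (delta_mx ord0 i)) (dg0 _).
case: (unliftP ord0 i) ip => [j|] -> ip.
  rewrite -integral12_prod_meas1//= integral0_eq// => t _.
  rewrite /fubini_F/= -[RHS](IHn (fun y => g (consrV (t, y))) j).
  - apply: eq_integral => y _; congr EFin.
    have [_ ->] := derive_comp_diff (delta_mx ord0 j) (is_diff_consrV2 t y)
      (dg _ I).
    by rewrite consrV_delta.
  - exact: (C1_on_comp_affine (fun y => is_diff_consrV2 t y) openT C1g).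
  - move=> y yM; apply: g0 => /cube0P h; apply: yM; apply/cube0P => k.
    by have := h (lift ord0 k); rewrite consrVS.
rewrite -integral21_prod_meas1//= integral0_eq// => y _.
rewrite /fubini_G/=.
apply: (@integral_derive_eq0 (fun t => g (consrV (t, y))) _ M) => //.
- move=> t; have [d dE] := derive_comp_diff (1 : R) (is_diff_consrV1 t y)
  (dg _ I).
  apply: DeriveDef; first exact: diff_derivable.
  by rewrite [LHS]dE scale1r.
- move=> t; apply: (@continuous_comp _ _ _ (fun t => consrV (t, y))
    ('D_(delta_mx ord0 ord0) g)); last exact: cdgT.
  by apply: differentiable_continuous; have [] := is_diff_consrV1 t y.
- move=> t tM; suff bM : ~ cube 0 M (consrV (t, y)) by split;
  [exact: g0|exact: dg0].
  by move=> /cube0P/(_ ord0); rewrite consrV0 leNgt tM.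
Qed.

End iterated_integrals.

(** * Compactly supported functions and the Euclidean norm *)

Section compact_support.
Context {R : realType}.
Implicit Types V W : normedModType R.

Lemma compact_closed_normed V (K : set V) : compact K -> closed K.
Proof. by apply: compact_closed; exact: norm_hausdorff. Qed.

Lemma C1_c_intro V W (U K : set V) (f : V -> W) :
  C1_on U f -> compact K -> K `<=` U -> (forall x, ~ K x -> f x = 0) ->
  C1_c U f.
Proof.
move=> C1f cK KU f0.
have fK : fun_support f `<=` K.
  rewrite /fun_support [X in _ `<=` X](iffLR (closure_id K)); last first.
    exact: compact_closed_normed.
  apply: closure_subset => x /= /eqP fx; apply: contrapT => /f0; exact: fx.
split=> //; last exact: subset_trans KU.
by apply: subclosed_compact fK => //; exact: closed_closure.
Qed.

(** Being zero on the open complement of its support, the extension by zero of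
    a compactly supported [C^1] function is [C^1] on the whole space. *)
Lemma C1_c_supp V W (U : set V) (f : V -> W) : open U -> C1_c U f ->
  exists K, [/\ compact K, K `<=` U, forall x, ~ K x -> f x = 0 & C1_on setT f].
Proof.
move=> oU [C1f cf fU]; exists (fun_support f).
have f0 x : ~ fun_support f x -> f x = 0.
  by move=> h; apply: contrapT => /eqP fx; apply: h; exact: subset_closure.
split=> //.
rewrite (_ : setT = U `|` ~` fun_support f).
  apply: C1_on_setU => //; have oC : open (~` fun_support f).
    by apply: closed_openC; exact: closed_closure.
  apply: (@C1_on_eq _ _ _ _ (cst 0)) => // [x /f0//|]; exact: C1_on_cst.
apply/seteqP; split=> // x _.
by have [/fU|] := pselect (fun_support f x); [left|right].
Qed.

Lemma C1_c_global V W (U : set V) (f : V -> W) : open U -> C1_c U f ->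
  C1_on setT f.
Proof. by move=> oU /(C1_c_supp oU)[K []]. Qed.

Lemma compact_supp_bounded V (K : set V) (f : V -> R) : compact K ->
  continuous f -> (forall x, ~ K x -> f x = 0) ->
  exists2 C, 0 < C & forall x, `|f x| <= C.
Proof.
move=> cK cf f0.
have [C C0 fC] := compact_continuous_bounded cK (fun x _ => cf x).
exists C => // x; have [/fC//|/f0->] := pselect (K x).
by rewrite normr0 ltW.
Qed.

Lemma eucl_norm_ge0 n (v : 'rV[R]_n) : 0 <= eucl_norm v.
Proof. exact: sqrtr_ge0. Qed.

Lemma coord_le_eucl n (v : 'rV[R]_n) i : `|v ord0 i| <= eucl_norm v.
Proof.
rewrite -sqrtr_sqr ler_wsqrtr// (bigD1 i)//= lerDl sumr_ge0// => j _.
exact: sqr_ge0.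
Qed.

(** Embedding constants are not tracked, so the Euclidean norm is only ever
    compared with the coordinates, through this lemma and [coord_le_eucl]. *)
Lemma eucl_norm_le n (v : 'rV[R]_n) : eucl_norm v <= \sum_i `|v ord0 i|.
Proof.
have s0 : 0 <= \sum_i `|v ord0 i| by rewrite sumr_ge0.
rewrite -[leRHS]ger0_norm// -sqrtr_sqr ler_wsqrtr// expr2 mulr_suml.
apply: ler_sum => i _; rewrite -real_normK ?num_real// expr2.
by rewrite ler_wpM2l// (bigD1 i)//= lerDl sumr_ge0.
Qed.

Lemma eucl_normZ n (a : R) (v : 'rV[R]_n) : eucl_norm (a *: v) = `|a| *
  eucl_norm v.
Proof.
rewrite /eucl_norm -sqrtr_sqr -sqrtrM ?sqr_ge0// mulr_sumr.
by under eq_bigr do rewrite mxE exprMn.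
Qed.

Lemma eucl_norm_delta n (i : 'I_n) (a : R) :
  eucl_norm (a *: delta_mx ord0 i : 'rV[R]_n) = `|a|.
Proof.
rewrite eucl_normZ /eucl_norm (bigD1 i)//= !mxE !eqxx expr1n big1 ?addr0.
  by rewrite sqrtr1 mulr1.
by move=> j ji; rewrite mxE (negPf ji) andbF expr0n.
Qed.

Lemma sup_norm_le1P (T : Type) n (U : set T) (f : T -> 'rV[R]_n) :
  (sup_norm U f <= 1)%E <-> forall x, U x -> eucl_norm (f x) <= 1.
Proof.
split=> [h x Ux|h].
  by rewrite -lee_fin; apply: le_trans h; apply: ereal_sup_ubound; exists x.
by apply: ub_ereal_sup => _ [x /h fx <-]; rewrite lee_fin.
Qed.

End compact_support.

(** * Integrals over an open set of finite measure *)

Section integrals_on_domain.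
Context {R : realType}.

Lemma integrable_Rsum d (T : measurableType d) (mu : {measure set T -> \bar R})
    (D : set T) I (s : seq I) (f : I -> T -> R) : measurable D ->
  (forall i, mu.-integrable D (EFin \o f i)) ->
  mu.-integrable D (EFin \o (fun x => \sum_(i <- s) f i x)).
Proof.
move=> mD fi; rewrite (_ : _ \o _ = fun x => (\sum_(i <- s) (f i x)%:E)%E).
  by apply: integrable_sum => // i _; exact: fi.
by apply/funext => x /=; rewrite sumEFin.
Qed.

Lemma Rintegral_sum d (T : measurableType d) (mu : {measure set T -> \bar R})
    (D : set T) I (s : seq I) (f : I -> T -> R) : measurable D ->
  (forall i, mu.-integrable D (EFin \o f i)) ->
  \int[mu]_(x in D) (\sum_(i <- s) f i x) =
  \sum_(i <- s) \int[mu]_(x in D) f i x.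
Proof.
move=> mD fi; elim: s => [|i s IHs].
  under eq_Rintegral do rewrite big_nil.
  by rewrite big_nil Rintegral_cst// mul0r.
under eq_Rintegral do rewrite big_cons.
by rewrite RintegralD// ?big_cons ?IHs//; exact: integrable_Rsum.
Qed.

Context {N : nat} (Omega : set 'rV[R]_N).
Context (oO : open Omega) (finO : (lebesgue_rV N Omega < +oo)%E).
Local Notation leb := (lebesgue_rV N).
Local Notation vol := (fine (leb Omega)).

Lemma measurable_domain : measurable Omega.
Proof. exact: open_measurable_rV. Qed.
Local Notation mO := measurable_domain.

Lemma vol_ge0 : 0 <= vol.
Proof. by rewrite fine_ge0. Qed.

Lemma bounded_integrable (f : 'rV[R]_N -> R) (C : R) :
  (forall x, Omega x -> {for x, continuous f}) ->
  (forall x, Omega x -> `|f x| <= C) -> leb.-integrable Omega (EFin \o f).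
Proof.
move=> cf fC.
apply: (@measurable_bounded_integrable _ _ _ leb f Omega mO) => //.
  exact: open_continuous_measurable_fun_rV.
exists C; split; [exact: num_real|move=> D CD x /fC hx].
exact: le_trans hx (ltW CD).
Qed.

Lemma bounded_mul_integrable (u f : 'rV[R]_N -> R) (C : R) :
  L1 Omega u ->
  (forall x, Omega x -> {for x, continuous f}) ->
  (forall x, Omega x -> `|f x| <= C) ->
  leb.-integrable Omega (EFin \o (fun x => u x * f x)).
Proof.
move=> L1u cf fC; rewrite (_ : _ \o _ = (EFin \o u) \* (EFin \o f))%E;
  last first.
  by apply/funext => x /=; rewrite EFinM.
apply: integrableMl => //; first exact: mO.
  exact: open_continuous_measurable_fun_rV.
exists C; split; [exact: num_real|move=> D CD x /fC hx].
exact: le_trans hx (ltW CD).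
Qed.

Lemma le_normr_Rintegral_vol (f : 'rV[R]_N -> R) (C : R) :
  leb.-integrable Omega (EFin \o f) ->
  (forall x, Omega x -> `|f x| <= C) ->
  `|\int[leb]_(x in Omega) f x| <= C * vol.
Proof.
move=> fi fC; apply: le_trans (le_normr_Rintegral mO fi) _.
rewrite -(Rintegral_cst _ mO); apply: le_Rintegral => //; first exact: mO.
  exact: integrable_norm.
apply: (@bounded_integrable _ `|C|) => // x _; exact: cst_continuous.
Qed.

(** Since the function and its derivatives vanish off a compact subset of
    [Omega], the integral over [Omega] is the one over the whole space. *)
Lemma Rintegral_partial_eq0 (K : set 'rV[R]_N) (g : 'rV[R]_N -> R) (i : 'I_N) :
  C1_on setT g -> compact K -> K `<=` Omega -> (forall x, ~ K x -> g x = 0) ->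
  \int[leb]_(x in Omega) 'D_(delta_mx ord0 i) g x = 0.
Proof.
move=> C1g cK KO g0; have [M M0 KM] := compact_sub_cube cK.
rewrite /Rintegral integral_mkcond (_ : _ \_ _ = fun x =>
  ('D_(delta_mx ord0 i) g x)%:E).
  rewrite (@integral_partial_eq0 _ _ M)// => x xM; apply: g0.
  by apply: contra_not xM; exact: KM.
apply/funext => x; rewrite patchE; case: ifPn => // /negP xO.
rewrite (derive_off_closed _ (compact_closed_normed cK) g0)//.
by apply: contra_not xO => /KO; rewrite inE.
Qed.

End integrals_on_domain.

(** * Differentiation under the integral sign *)

Section parametric_integrals.
Context {R : realType}.

(** The tube lemma: continuity at each point of the compact projection of the
    support is made uniform in the second variable by compactness. *)
Lemma continuous_unif_fst (V W : normedModType R) (K : set (V * W))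
    (B : V * W -> R) (x : V) (e : R) : compact K -> continuous B ->
  (forall z, ~ K z -> B z = 0) -> 0 < e ->
  \forall x' \near x, forall y, `|B (x', y) - B (x, y)| <= e.
Proof.
move=> cK cB B0 e0.
have cK2 : compact (snd @` K).
  apply: continuous_compact => //; apply: continuous_subspaceT => z.
  exact: cvg_snd.
have /compact_near_coveringP/near_covering_withinP cov := cK2.
near=> x' => y.
have [Ky|Ky] := pselect ((snd @` K) y); last first.
  rewrite !B0 ?subrr ?normr0 ?ltW// => [h|h]; apply: Ky.
    by exists (x, y).
  by exists (x', y).
move: y Ky; near: x'.
suff : \forall x' \near x, (snd @` K) `<=`
  (fun y => `|B (x', y) - B (x, y)| < e).
  by apply: filterS => x' h y /h/ltW.
apply: (cov _ _ (fun x' y => `|B (x', y) - B (x, y)| < e)) => y _.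
have /cvgrPdist_lt/(_ (e / 2)) := cB (x, y).
rewrite divr_gt0// => /(_ isT) [[P1 P2] /= [xP1 yP2] P12].
exists (P2, P1) => //= -[y' x'] /= [y'P x'P] _.
have xx : P1 x by exact: nbhs_singleton.
have := P12 (x', y') (conj x'P y'P); have := P12 (x, y') (conj xx y'P) => /=.
move=> h1 h2; rewrite (_ : _ - _ = (B (x, y) - B (x, y')) -
  (B (x, y) - B (x', y'))).
  by rewrite (le_lt_trans (ler_normB _ _))// (splitr e) ltrD.
by lra.
Unshelve. all: by end_near. Qed.

Lemma continuous_sumr (T : topologicalType) n (f : 'I_n -> T -> R) (x : T) :
  (forall i, {for x, continuous (f i)}) ->
  {for x, continuous (fun z => \sum_i f i z)}.
Proof.
move=> cf; have -> : (fun z => \sum_i f i z) = \sum_i f i.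
  by apply/funext => z; rewrite fct_sumE.
elim/big_ind : _ => [|f1 f2 c1 c2|i _]; last exact: cf.
  exact: cst_continuous.
exact: (@continuousD R R^o).
Qed.

Lemma is_diff_line (V W : normedModType R) (h x : V) (y : W) (t : R) :
  is_diff t (fun t : R => (t *: h + x, y)) (fun s => (s *: h, 0)).
Proof.
have dl : is_diff t (fun t : R => t *: h + x) (fun s => s *: h).
  have : is_diff t (( *:%R ^~ h) + cst x) (( *:%R ^~ h) + (0 : R -> V)).
    by apply: is_diffD.
  by congr is_diff_def; rewrite addr0.
have : is_diff t (fun t : R => (t *: h + x, cst y t))
    (fun s => (s *: h, (0 : R -> W) s)).
  by apply: is_diff_pair.
by [].
Qed.

Lemma derive_fst_sum n (W : normedModType R) (A : 'rV[R]_n * W -> R) z h :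
  differentiable A z ->
  'D_(h, 0) A z = \sum_i h ord0 i * 'D_(delta_mx ord0 i, 0) A z.
Proof.
move=> dA; rewrite deriveE// (_ : (h, 0) =
  \sum_i h ord0 i *: (delta_mx ord0 i, 0) :> 'rV[R]_n * W).
  by rewrite linear_sum; apply: eq_bigr => i _; rewrite linearZ deriveE.
rewrite {1}(row_sum_delta h); apply/esym.
elim/big_rec2: _ => // i a b _ ->.
by congr pair; rewrite /= scaler0 addr0.
Qed.

(** Differentiability in the first variable, uniformly in the second. On the
    segment from [x] to [h + x] the mean value theorem reduces the error to the
    variation of the partial derivatives, which [continuous_unif_fst] controls
    uniformly. *)
Lemma diff_fst_unif n (W : normedModType R) (K : set ('rV[R]_n * W))
    (A : 'rV[R]_n * W -> R) (x : 'rV[R]_n) (e : R) :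
  C1_on setT A -> compact K -> (forall z, ~ K z -> A z = 0) -> 0 < e ->
  \forall h \near (0 : 'rV[R]_n), forall y,
    `|A (h + x, y) - A (x, y) -
      \sum_i h ord0 i * 'D_(delta_mx ord0 i, 0) A (x, y)| <= e * `|h|.
Proof.
move=> [dA cdA] cK A0 e0.
have dA0 v z : ~ K z -> 'D_v A z = 0.
  exact: derive_off_closed (compact_closed_normed cK) A0.
(* n.+1 instead of n avoids a division by zero in dimension 0. *)
pose e' := e / n.+1%:R.
have e'0 : 0 < e' by rewrite divr_gt0.
have H i : \forall x' \near x, forall y, `|'D_(delta_mx ord0 i, 0) A (x', y) -
    'D_(delta_mx ord0 i, 0) A (x, y)| <= e'.
  by apply: continuous_unif_fst cK _ (dA0 _) e'0 => z; exact: cdA.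
have : \forall x' \near x, forall i y, `|'D_(delta_mx ord0 i, 0) A (x', y) -
    'D_(delta_mx ord0 i, 0) A (x, y)| <= e' by exact: filter_forall H.
move=> /nbhs_ballP[d /= d0 xd].
near=> h => y.
have hd t : 0 <= t <= 1 -> ball x d (t *: h + x).
  move=> /andP[t0 t1]; rewrite -ball_normE/= opprD addrCA subrr addr0 normrN.
  rewrite normrZ ger0_norm//; apply: (@le_lt_trans _ _ `|h|).
    by rewrite ler_piMl.
  near: h; have : \forall h \near (0 : 'rV[R]_n), ball 0 d h
    by exact: nbhsx_ballx.
  by apply: filterS => h; rewrite -ball_normE/= sub0r normrN.
pose c i := 'D_(delta_mx ord0 i, 0) A (x, y).
pose S := \sum_i h ord0 i * c i.
pose F (t : R) := A (t *: h + x, y) - t * S.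
pose dF (t : R) := 'D_(h, 0) A (t *: h + x, y) - S.
have isF (t : R) : is_derive t (1 : R) F (dF t).
  apply: (@is_deriveB _ _ _ (fun t : R => A (t *: h + x, y)) (fun t => t * S)).
    have [d1 d2] := derive_comp_diff (1 : R) (is_diff_line h x y t) (dA _ I).
    rewrite scale1r in d2.
    apply: DeriveDef; [exact: diff_derivable|exact: d2].
  have : is_derive t (1 : R) ( *:%R ^~ S : R -> R) S.
    have [d1 d2] := is_diff_scalel t (S : R^o).
    apply: DeriveDef; first exact: diff_derivable.
    by rewrite deriveE// d2 scale1r.
  by [].
have cF : continuous F.
  by move=> t; apply: differentiable_continuous; apply/derivable1_diffP;
    have [] := isF t.
have [|t t01] := @MVT_segment R F dF 0 1 ler01 (fun t _ => isF t).
  exact: continuous_subspaceT.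
rewrite subr0 mulr1 /F scale1r scale0r add0r mul1r mul0r subr0 addrAC => ->.
rewrite /dF derive_fst_sum; last exact: dA.
rewrite -sumrB; apply: le_trans (ler_norm_sum _ _ _) _.
apply: (@le_trans _ _ (\sum_(i < n) e' * `|h|)).
  apply: ler_sum => i _; rewrite -mulrBr normrM mulrC.
  apply: ler_pM => //; last exact: coord_le_norm.
  by apply: xd; apply: hd; move: t01; rewrite in_itv.
rewrite sumr_const card_ord -mulrnAl ler_wpM2r// /e' -mulr_natr.
rewrite mulrAC ler_pdivrMr//. 
by apply: ler_wpM2l; [exact: ltW|rewrite ler_nat].
Unshelve. all: by end_near. Qed.

Context {N : nat} (Omega : set 'rV[R]_N).
Context (oO : open Omega) (finO : (lebesgue_rV N Omega < +oo)%E).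
Local Notation leb := (lebesgue_rV N).
Local Notation vol := (fine (leb Omega)).
Let mO := measurable_domain oO.

Lemma integrable_section (V : normedModType R) (K : set (V * 'rV[R]_N))
    (B : V * 'rV[R]_N -> R) (x : V) : compact K -> continuous B ->
  (forall z, ~ K z -> B z = 0) ->
  leb.-integrable Omega (EFin \o (fun y => B (x, y))).
Proof.
move=> cK cB B0; have [C _ BC] := compact_supp_bounded cK cB B0.
apply: (bounded_integrable oO finO (C := C)) => // y _.
apply: (@continuous_comp _ _ _ (fun y => (x, y)) B); last exact: cB.
have : differentiable (fun y => (cst x y, id y)) y
  by apply: differentiable_pair.
exact: differentiable_continuous.
Qed.

Lemma continuous_parametric (V : normedModType R) (K : set (V * 'rV[R]_N))
    (B : V * 'rV[R]_N -> R) : compact K -> continuous B ->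
  (forall z, ~ K z -> B z = 0) ->
  continuous (fun x => \int[leb]_(y in Omega) B (x, y)).
Proof.
move=> cK cB B0 x.
have iB z := integrable_section z cK cB B0.
apply/cvgrPdist_le => e e0.
have v0 : 0 < vol + 1 by rewrite ltr_wpDl// vol_ge0.
near=> x'.
rewrite -RintegralB//.
apply: (@le_trans _ _ (e / (vol + 1) * vol)).
  apply: le_normr_Rintegral_vol => //.
    by have := integrableB mO (iB x) (iB x'); congr integrable.
  move=> y _; rewrite distrC; move: y; near: x'.
  by apply: continuous_unif_fst cK cB B0 _; rewrite divr_gt0.
by rewrite mulrAC ler_pdivrMr// ler_wpM2l ?ltW//; lra.
Unshelve. all: by end_near. Qed.

(** The uniform first-order expansion [diff_fst_unif] can be integrated in [y],
    because [Omega] has finite measure. *)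
Lemma C1_parametric (K : set ('rV[R]_N * 'rV[R]_N))
    (A : 'rV[R]_N * 'rV[R]_N -> R) :
  C1_on setT A -> compact K -> (forall z, ~ K z -> A z = 0) ->
  C1_on setT (fun x => \int[leb]_(y in Omega) A (x, y)) /\
  forall i x, 'D_(delta_mx ord0 i) (fun x => \int[leb]_(y in Omega) A (x, y)) x
    =
    \int[leb]_(y in Omega) 'D_(delta_mx ord0 i, 0) A (x, y).
Proof.
move=> C1A cK A0; have [dA cdA] := C1A.
have cA : continuous A by move=> z; exact: (C1_on_continuous C1A).
have cD v : continuous ('D_v A) by move=> z; exact: cdA.
have dA0 v z : ~ K z -> 'D_v A z = 0.
  exact: derive_off_closed (compact_closed_normed cK) A0.
have iA z := integrable_section z cK cA A0.
have iD v z := integrable_section z cK (cD v) (dA0 v).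
set psi := fun x => _.
pose c i x := \int[leb]_(y in Omega) 'D_(delta_mx ord0 i, 0) A (x, y).
pose L x (h : 'rV[R]_N) : R := \sum_i h ord0 i * c i x.
have linL x : linear (L x).
  move=> a u v; rewrite /L scaler_sumr -big_split/=; apply: eq_bigr => i _.
  by rewrite !mxE mulrDl -scalerAl.
have isd x : is_diff x psi (L x).
  apply: is_diff_approx => [||e e0]; first exact: linL.
    move=> h; apply: continuous_sumr => i.
    apply: (@continuousM R _ _ (cst (c i x))); last exact: cst_continuous.
    exact: coord_continuous.
  have v0 : 0 < vol + 1 by rewrite ltr_wpDl// vol_ge0.
  (* vol + 1 rather than vol, which may be zero. *)
  have e'0 : 0 < e / (vol + 1) by rewrite divr_gt0.
  near=> h.
  have iT i : leb.-integrable Omega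
      (EFin \o (fun y => h ord0 i * 'D_(delta_mx ord0 i, 0) A (x, y))).
    exact: (integrableZl mO (h ord0 i) (iD _ x)).
  have iS := integrable_Rsum (index_enum 'I_N) mO iT.
  have iB : leb.-integrable Omega (EFin \o (fun y => A (h + x, y) - A (x, y))).
    exact: (integrableB mO (iA _) (iA x)).
  rewrite /psi -RintegralB// /L.
  under eq_bigr do rewrite /c -RintegralZl//.
  rewrite -Rintegral_sum// -RintegralB//.
  apply: (@le_trans _ _ (e / (vol + 1) * `|h| * vol)).
    apply: le_normr_Rintegral_vol => //.
      exact: (integrableB mO iB iS).
    move=> y _; move: y; near: h.
    exact: (diff_fst_unif x C1A cK A0 e'0).
  rewrite mulrAC ler_wpM2r// mulrAC ler_pdivrMr//.
  by apply: ler_wpM2l; [exact: ltW|lra].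
have DE v x : 'D_v psi x = L x v.
  by have [d dE] := isd x; rewrite deriveE// dE.
split; last first.
  move=> i x; rewrite DE /L (bigD1 i)//= big1 => [|j ji].
    by rewrite addr0 mxE !eqxx mul1r.
  by rewrite mxE (negPf ji) andbF mul0r.
apply: (@C1_onI _ _ _ _ _ (fun v x => L x v)) => //.
- exact: openT.
- move=> v x _; apply: continuous_sumr => i.
  apply: (@continuousM R _ (cst (v ord0 i))); first exact: cst_continuous.
  exact: (continuous_parametric cK (cD _) (dA0 _)).
Unshelve. all: by end_near. Qed.

End parametric_integrals.

(** * Bumps on cubes *)

Section bumps.
Context {R : realType}.

(** The square makes the positive part continuously differentiable; products of
    its values are the bumps below. *)
Definition sqpos (t : R) : R := Num.max 0 t ^+ 2.

Lemma sqpos_ge0 t : 0 <= sqpos t. Proof. exact: sqr_ge0. Qed.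

(** In all positions of [t] and [s + t] with respect to [0], the first-order
    error at [t] is at most [s ^ 2]. *)
Lemma is_derive_sqpos (t : R) : is_derive t (1 : R) sqpos (2 * Num.max 0 t).
Proof.
have [d dE] : is_diff t sqpos ( *:%R (2 * Num.max 0 t)).
  apply: is_diff_approx; [|exact: scaler_continuous|].
    by move=> a u v; rewrite scalerDr !scalerA (mulrC a).
  move=> e e0; near=> s.
  have se : `|s| <= e.
    by near: s; have := @nbhs0_le R R^o _ e0.
  apply: (@le_trans _ _ (`|s| * `|s|)); last by rewrite ler_wpM2r.
  rewrite -normrM ger0_norm -?expr2 ?sqr_ge0// /sqpos.
  rewrite -[X in _ - X]/(2 * Num.max 0 t * s).
  rewrite ler_norml; have [t0|t0] := leP t 0; have [ts0|ts0] := leP (s + t) 0;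
    rewrite ?(max_l t0) ?(max_l ts0) ?(max_r (ltW t0)) ?(max_r (ltW ts0));
    apply/andP; split; nra.
apply: DeriveDef; first exact: diff_derivable.
by rewrite deriveE// dE [LHS]mulr1.
Unshelve. all: by end_near. Qed.

Lemma continuous_derive_sqpos : continuous (derive1 sqpos).
Proof.
have -> : derive1 sqpos = fun t => 2 * Num.max 0 t.
  by apply/funext => t; rewrite derive1E; have [_ ->] := is_derive_sqpos t.
move=> t; apply: cvgM; first exact: cvg_cst.
apply: continuous_max; [exact: cvg_cst|exact: cvg_id].
Qed.

Lemma C1_on_prod (V : normedModType R) (U : set V) I (s : seq I)
    (f : I -> V -> R) : open U ->
  (forall i, C1_on U (f i)) -> C1_on U (fun x => \prod_(i <- s) f i x).
Proof.
move=> oU C1f; elim: s => [|i s IHs].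
  rewrite (_ : (fun x => _) = cst 1); first exact: C1_on_cst.
  by apply/funext => x; rewrite big_nil.
rewrite (_ : (fun x => _) = fun x => f i x * \prod_(i <- s) f i x).
  exact: (C1_onM oU (C1f i) IHs).
by apply/funext => x; rewrite big_cons.
Qed.

Context {N : nat}.

Definition cube_bump (c : 'rV[R]_N) (r : R) (x : 'rV[R]_N) : R :=
  \prod_i sqpos (1 - ((x ord0 i - c ord0 i) / r) ^+ 2).

Lemma C1_on_cube_bump c r : C1_on setT (cube_bump c r).
Proof.
apply: C1_on_prod; first exact: openT.
move=> i; apply: (@C1_on_comp_real _ _ _ sqpos
  (fun x : 'rV[R]_N => 1 - ((x ord0 i - c ord0 i) / r) ^+ 2)).
- exact: openT.
- by move=> t; have [] := is_derive_sqpos t.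
- exact: continuous_derive_sqpos.
- have oT : open (setT : set 'rV[R]_N) by exact: openT.
  apply: C1_onD => //; first exact: C1_on_cst.
  have Ci : C1_on setT (fun x : 'rV[R]_N => (x ord0 i - c ord0 i) / r).
    apply: C1_onM => //; last exact: C1_on_cst.
    apply: C1_onD => //; [exact: C1_on_coord|exact: C1_on_cst].
  exact: (C1_onN oT (C1_onM oT Ci Ci)).
Qed.

Lemma cube_bump_ge0 c r x : 0 <= cube_bump c r x.
Proof. by apply: prodr_ge0 => i _; exact: sqpos_ge0. Qed.

Lemma cube_bump_le1 c r x : cube_bump c r x <= 1.
Proof.
apply: prodr_ile1 => i _; rewrite sqpos_ge0/=.
have := sqr_ge0 ((x ord0 i - c ord0 i) / r); rewrite /sqpos.
by set a := _ ^+ 2; have [a1|a1] := leP (1 - a) 0;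
  rewrite ?(max_l a1) ?(max_r (ltW a1)); nra.
Qed.

Lemma cube_bump_factor_gt0 (c x r : R) : 0 < r ->
  (0 < sqpos (1 - ((x - c) / r) ^+ 2)) = (`|c - x| < r).
Proof.
move=> r0; rewrite /sqpos exprn_even_gt0//=.
have -> : (`|c - x| < r) = (((x - c) / r) ^+ 2 < 1).
  rewrite distrC -[in LHS](mul1r r) -ltr_pdivrMr//.
  have -> : `|x - c| / r = `|(x - c) / r|.
    by rewrite normrM normfV (gtr0_norm r0).
  by rewrite -[LHS](@ltr_pXn2r _ 2)// ?nnegrE// expr1n real_normK ?num_real.
set a := _ ^+ 2; apply/idP/idP => [h|a1].
  by rewrite ltNge; apply: contra h => a1; apply/eqP/max_l; lra.
by rewrite max_r ?subr_ge0 ?(ltW a1)// subr_eq0 gt_eqF.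
Qed.

Lemma cube_bump_gt0 c r x : 0 < r -> ball c r x -> 0 < cube_bump c r x.
Proof.
move=> r0 /(ball_rVE _ _ r0) h; apply: prodr_gt0 => i _.
by rewrite cube_bump_factor_gt0.
Qed.

Lemma cube_bump_eq0 c r x : 0 < r -> ~ ball c r x -> cube_bump c r x = 0.
Proof.
move=> r0 cx; have [i ci] : exists i, ~ `|c ord0 i - x ord0 i| < r.
  by apply/existsNP; apply: contra_not cx => h; apply/ball_rVE.
apply/eqP; apply/prodf_eq0; exists i => //.
by rewrite eq_sym eq_le sqpos_ge0/= leNgt cube_bump_factor_gt0//; exact/negP.
Qed.

Lemma cube_bump_off_cube c r x : 0 < r -> ~ cube c r x -> cube_bump c r x = 0.
Proof.
by move=> r0 h; apply: cube_bump_eq0 => //; apply: contra_not h;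
  exact: ball_sub_cube.
Qed.

(** By continuity [f] stays above half of [f x0] on a small cube, and cubes have
    positive measure. *)
Lemma Rintegral_gt0 (Omega : set 'rV[R]_N) (f : 'rV[R]_N -> R) (x0 : 'rV[R]_N) :
  open Omega -> (lebesgue_rV N).-integrable Omega (EFin \o f) ->
  (forall x, Omega x -> 0 <= f x) -> {for x0, continuous f} ->
  Omega x0 -> 0 < f x0 -> 0 < \int[lebesgue_rV N]_(x in Omega) f x.
Proof.
move=> oO fi f0 cf Ox0 fx0; have mO := open_measurable_rV oO.
have : \forall x \near x0, Omega x /\ f x0 / 2 < f x.
  have h1 : \forall x \near x0, Omega x by exact: open_nbhs_nbhs.
  have h2 : \forall x \near x0, f x0 / 2 < f x.
    by apply: (cvgr_gt _ cf); rewrite ltr_pdivrMr//; lra.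
  by apply: filterS2 h1 h2.
move=> /nbhs_ballP[d /= d0 dO].
have d20 : 0 < d / 2 by rewrite divr_gt0.
have QO x : cube x0 (d / 2) x -> Omega x /\ f x0 / 2 < f x.
  by move=> h; apply: dO; apply: cube_sub_ball h => //; lra.
have mQ := measurable_cube x0 (d / 2).
have mf := measurable_int _ fi.
rewrite -lte_fin /Rintegral fineK; last exact: integrable_fin_num.
apply: (@lt_le_trans _ _ (\int[lebesgue_rV N]_(x in cube x0 (d / 2))
  (f x)%:E)%E).
  apply: (@lt_le_trans _ _ ((f x0 / 2)%:E * lebesgue_rV N (cube x0 (d / 2)))%E).
    by rewrite mule_gt0 ?lebesgue_cube_gt0// lte_fin divr_gt0.
  rewrite -integral_cst//; apply: ge0_le_integral => //.
  - by move=> x _; rewrite lee_fin divr_ge0// ltW.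
  - by apply: measurable_funS mf => // x /QO[].
  - by move=> x /QO[_ /ltW]; rewrite lee_fin.
apply: ge0_subset_integral => //; first by move=> x /QO[].
Qed.

End bumps.

(** * Cutoff functions and exhaustion of an open set *)

Section exhaustion.
Context {R : realType} {N : nat}.
Implicit Types (U : set 'rV[R]_N).

(** Scalar compactly supported [C^1] functions. Asking for some compact set off
    which [f] vanishes, rather than for a condition on the closure of
    [f != 0], makes the notion visibly stable under sums and products. *)
Definition cutoff (V : normedModType R) (U : set V) (f : V -> R) :=
  C1_on setT f /\
  exists K, [/\ compact K, K `<=` U & forall x, ~ K x -> f x = 0].

Lemma cutoffD (V : normedModType R) (U : set V) f g :
  cutoff U f -> cutoff U g -> cutoff U (fun x => f x + g x).
Proof.
move=> [C1f [K [cK KU f0]]] [C1g [L [cL LU g0]]].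
split; first exact: (C1_onD openT C1f C1g).
exists (K `|` L); split.
- exact: compactU.
- by move=> x [/KU|/LU].
- by move=> x /not_orP[Kx Lx]; rewrite f0// g0// addr0.
Qed.

Lemma cutoff0 (V : normedModType R) (U : set V) : cutoff U (cst 0).
Proof.
by split; [exact: C1_on_cst|exists set0; split=> //; exact: compact0].
Qed.

Lemma cutoff_cube_bump U c r : 0 < r -> cube c r `<=` U -> cutoff U
  (cube_bump c r).
Proof.
move=> r0 cU; split; first exact: C1_on_cube_bump.
exists (cube c r); split=> //; first exact: compact_cube.
by move=> x; exact: cube_bump_off_cube.
Qed.

Lemma open_bump U (x : 'rV[R]_N) : open U -> U x ->
  exists2 r, 0 < r & cube x r `<=` U.
Proof.
move=> oU Ux; have /nbhs_ballP[d /= d0 dU] : nbhs x U by exact: open_nbhs_nbhs.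
exists (d / 2); first by rewrite divr_gt0.
by apply: subset_trans dU; apply: cube_sub_ball => //; lra.
Qed.

(** One bump for each rational ball whose closed cube lies in [U]. *)
Lemma open_positive_seq U : open U ->
  exists g : nat -> 'rV[R]_N -> R, (forall j, cutoff U (g j)) /\
    (forall j x, 0 <= g j x) /\ (forall x, U x -> exists j, 0 < g j x).
Proof.
move=> oU.
pose q (p : 'rV[rat]_N * nat) : 'rV[R]_N := map_mx ratr p.1.
pose r (p : 'rV[rat]_N * nat) : R := p.2.+1%:R^-1.
have r0 p : 0 < r p by rewrite invr_gt0.
pose b p := if pselect (cube (q p) (r p) `<=` U) then cube_bump (q p) (r p) else
  cst 0.
(* Indices that encode no ball, or a ball too large, contribute zero. *)
pose g j := if unpickle j is Some p then b p else cst 0.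
have bU p : cutoff U (b p).
  by rewrite /b; case: pselect => h; [exact: cutoff_cube_bump|exact: cutoff0].
exists g; split=> [j|]; last split=> [j x|x Ux].
- by rewrite /g; case: unpickle => [p|]; [exact: bU|exact: cutoff0].
- rewrite /g; case: unpickle => [p|//]; rewrite /b; case: pselect => h //.
  exact: cube_bump_ge0.
- have [c [k [cx cU]]] := open_rat_ball oU Ux.
  exists (pickle (c, k)); rewrite /g pickleK /b; case: pselect => h.
    exact: cube_bump_gt0.
  exfalso; apply: h; apply: subset_trans cU; apply: cube_sub_ball.
    by rewrite mulrn_wgt0.
  by rewrite /r/= mulr2n ltrDl invr_gt0.
Qed.

(** Sum finitely many of the functions of [open_positive_seq] and saturate: at a
    point of [U] the partial sums [s n] are eventually bounded below by a
    positive number, hence [n * s n] tends to infinity and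
    [n * s n / (1 + n * s n)] to [1]. *)
Lemma open_exhaustion U : open U ->
  exists eta : nat -> 'rV[R]_N -> R, (forall n, cutoff U (eta n)) /\
    (forall n x, 0 <= eta n x <= 1) /\
    (forall x, U x -> eta n x @[n --> \oo] --> (1 : R)).
Proof.
move=> oU; have [g [gU [g0 gpos]]] := open_positive_seq oU.
pose s n x := \sum_(j < n) g j x.
have s0 n x : 0 <= s n x by apply: sumr_ge0.
have sU n : cutoff U (s n).
  elim: n => [|n IHn].
    by rewrite (_ : s 0 = cst 0); [exact: cutoff0|
      apply/funext => x; rewrite /s big_ord0].
  rewrite (_ : s n.+1 = fun x => s n x + g n x); first exact: cutoffD.
  by apply/funext => x; rewrite /s big_ord_recr.
have d0 n x : 0 < 1 + n%:R * s n x by rewrite ltr_pwDl// mulr_ge0.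
have oT : open (setT : set 'rV[R]_N) by exact: openT.
(* The saturation t / (1 + t), written with a single inverse. *)
exists (fun n x => 1 - (1 + n%:R * s n x)^-1); split=> [n|]; last split=>
  [n x|x Ux].
- have [C1s [K [cK KU sK]]] := sU n; split.
    pose c (a : R) := @C1_on_cst R 'rV[R]_N R setT a.
    have C1d := C1_onD oT (c 1) (C1_onM oT (c n%:R) C1s).
    have dn0 x : setT x -> 1 + n%:R * s n x != 0 by rewrite gt_eqF.
    exact: (C1_onD oT (c 1) (C1_onN oT (C1_onV oT dn0 C1d))).
  by exists K; split=> // x /sK->; rewrite mulr0 addr0 invr1 subrr.
- rewrite subr_ge0 gerBl invr_ge0 (ltW (d0 n x)) andbT invf_le1//.
  by rewrite lerDl mulr_ge0.
- have [j gj] := gpos x Ux.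
  apply/cvgrPdist_le => e e0; near=> n.
  rewrite subKr ger0_norm ?invr_ge0 ?(ltW (d0 n x))//.
  rewrite -[leRHS]invrK lef_pV2 ?posrE ?invr_gt0//.
  apply: (@le_trans _ _ (n%:R * g j x)).
    rewrite -ler_pdivrMr//; near: n; exact: nbhs_infty_ger.
  apply: (@le_trans _ _ (n%:R * s n x)); last by rewrite lerDr.
  rewrite ler_wpM2l//.
  have jn : (j < n)%N by near: n; exact: nbhs_infty_gt.
  by rewrite /s (bigD1 (Ordinal jn))//= lerDl sumr_ge0.
Unshelve. all: by end_near. Qed.

End exhaustion.

(** * Products of cutoffs, and vector fields *)

Section cutoff_products.
Context {R : realType}.
Implicit Types V W : normedModType R.

Lemma openX V W (A : set V) (B : set W) : open A -> open B -> open (A `*` B).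
Proof.
rewrite !openE => oA oB [x y] [/= Ax By].
by exists (A, B) => //; split; [exact: oA|exact: oB].
Qed.

Lemma C1_on_fst V W (f : V -> R) :
  C1_on setT f -> C1_on setT (fun z : V * W => f z.1).
Proof. exact: (C1_on_comp_affine (@is_diff_fst R V W) openT). Qed.

Lemma C1_on_snd V W (f : W -> R) :
  C1_on setT f -> C1_on setT (fun z : V * W => f z.2).
Proof. exact: (C1_on_comp_affine (@is_diff_snd R V W) openT). Qed.

(** Only the values of [a] on [U] matter, so this applies to the weight and to
    its inverse, whose values outside [Omega `*` Omega] are arbitrary. *)
Lemma cutoffM V (U : set V) (a f : V -> R) : open U ->
  C1_on U a -> cutoff U f -> cutoff U (fun z => a z * f z).
Proof.
move=> oU C1a [C1f [K [cK KU f0]]].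
have af0 z : ~ K z -> a z * f z = 0 by move=> /f0->; rewrite mulr0.
split; last by exists K.
apply: (C1_c_global oU); apply: (C1_c_intro _ cK KU af0).
exact: (C1_onM oU C1a (C1_on_sub (@subsetT _ U) C1f)).
Qed.

Lemma cutoffZ V (U : set V) (a : R) (f : V -> R) :
  cutoff U f -> cutoff U (fun z => a * f z).
Proof.
move=> [C1f [K [cK KU f0]]]; split.
  exact: (C1_onM openT (C1_on_cst _ a) C1f).
by exists K; split=> // z /f0->; rewrite mulr0.
Qed.

Lemma cutoffX V W (U : set V) (U' : set W) (f : V -> R) (g : W -> R) :
  cutoff U f -> cutoff U' g -> cutoff (U `*` U') (fun z => f z.1 * g z.2).
Proof.
move=> [C1f [K [cK KU f0]]] [C1g [L [cL LU g0]]]; split.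
  exact: (C1_onM openT (C1_on_fst _ C1f) (C1_on_snd _ C1g)).
exists (K `*` L); split.
- exact: compact_setX.
- by move=> [x y] [/= /KU ? /LU ?].
- move=> [x y] /not_andP[/= /f0->|/= /g0->]; first by rewrite mul0r.
  by rewrite mulr0.
Qed.

Lemma cutoff_swap V (U : set V) (f : V * V -> R) :
  cutoff (U `*` U) f -> cutoff (U `*` U) (fun z => f (z.2, z.1)).
Proof.
move=> [C1f [K [cK KU f0]]]; split.
  exact: (C1_on_comp_affine (@is_diff_swap R V V) openT C1f).
exists ((fun z => (z.2, z.1)) @` K); split.
- apply: continuous_compact => //; apply: continuous_subspaceT => z.
  by apply: differentiable_continuous; have [] := is_diff_swap z.
- by move=> _ [[x y] /KU [/= Ux Uy] <-].
- by move=> [x y] h; apply: f0 => Kyx; apply: h; exists (y, x).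
Qed.

Lemma cutoff_off V (U : set V) (f : V -> R) x : cutoff U f -> ~ U x -> f x = 0.
Proof. by move=> [_ [K [_ KU f0]]] Ux; apply: f0 => /KU. Qed.

Lemma cutoff_continuous V (U : set V) (f : V -> R) : cutoff U f -> continuous f.
Proof. by move=> [C1f _] x; exact: (C1_on_continuous C1f). Qed.

Lemma cutoff_derive V (U : set V) (f : V -> R) v : cutoff U f ->
  continuous ('D_v f) /\
  exists K, [/\ compact K, K `<=` U & forall x, ~ K x -> 'D_v f x = 0].
Proof.
move=> [[df cf] [K [cK KU f0]]]; split; first by move=> x; exact: cf.
exists K; split=> // x.
exact: derive_off_closed (compact_closed_normed cK) f0.
Qed.

Lemma cutoff_bounded V (U : set V) (f : V -> R) : cutoff U f ->
  exists2 C, 0 < C & forall x, `|f x| <= C.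
Proof.
move=> cf; have [_ [K [cK KU f0]]] := cf.
by apply: compact_supp_bounded cK _ f0; exact: cutoff_continuous cf.
Qed.

Lemma cutoff_derive_bounded V (U : set V) (f : V -> R) v : cutoff U f ->
  exists2 C, 0 < C & forall x, `|'D_v f x| <= C.
Proof.
by move=> /(cutoff_derive v)[c [K [cK KU f0]]];
  exact: compact_supp_bounded cK _ f0.
Qed.

Lemma C1_c_cutoffP V n (U : set V) (F : V -> 'rV[R]_n) : open U ->
  C1_c U F <-> forall i, cutoff U (fun x => F x ord0 i).
Proof.
move=> oU; split=> [cF i|cF].
  have [K [cK KU F0 C1F]] := C1_c_supp oU cF; split.
    by move/(C1_on_rVP _ openT) : C1F; exact.
  by exists K; split=> // x /F0->; rewrite mxE.
have /choice[K hK] : forall i, exists K, [/\ compact K, K `<=` U &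
    forall x, ~ K x -> F x ord0 i = 0] by move=> i; have [_] := cF i.
apply: (@C1_c_intro _ _ _ _ (\big[setU/set0]_(i < n) K i)).
- apply/(C1_on_rVP _ oU) => i; have [C1F _] := cF i.
  exact: C1_on_sub C1F.
- by apply: bigsetU_compact => i _; have [] := hK i.
- by rewrite -bigcup_seq => x [i _]; have [_ + _] := hK i; exact.
- move=> x; rewrite -bigcup_seq => Kx; apply/rowP => i; rewrite mxE.
  have [_ _ ->//] := hK i; apply: contra_not Kx => Kix; exists i => //=.
  exact: mem_index_enum.
Qed.

End cutoff_products.

(** * Local and nonlocal total variations *)

Section variations.
Context {R : realType} {N : nat} (Omega : set 'rV[R]_N).
Context (w : 'rV[R]_N * 'rV[R]_N -> R).
Context (oO : open Omega) (finO : (lebesgue_rV N Omega < +oo)%E).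
Implicit Types u : 'rV[R]_N -> R.
Local Notation leb := (lebesgue_rV N).
Local Notation vol := (fine (leb Omega)).
Let mO := measurable_domain oO.

Lemma C1_c_0 (V W : normedModType R) (U : set V) : C1_c U (cst 0 : V -> W).
Proof.
apply: (C1_c_intro (K := set0)) => //; [exact: C1_on_cst|exact: compact0].
Qed.

Lemma sup_norm_0 (V : Type) n (U : set V) :
  (sup_norm U (cst 0%R : V -> 'rV[R]_n) <= 1)%E.
Proof.
apply/sup_norm_le1P => x _; rewrite -(scale0r (0 : 'rV[R]_n)) eucl_normZ.
by rewrite normr0 mul0r.
Qed.

Lemma NLTV_leP u (t : R) : (NLTV Omega w u <= t%:E)%E <->
  forall phi, C1_c (Omega `*` Omega) phi ->
    (forall z, (Omega `*` Omega) z -> eucl_norm (phi z) <= 1) ->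
    \int[leb]_(x in Omega) (u x * div_w Omega w phi x) <= t.
Proof.
split=> [h phi c1 /sup_norm_le1P s1|h].
  by rewrite -lee_fin; apply: le_trans h; apply: ereal_sup_ubound; exists phi.
apply: ub_ereal_sup => _ [phi [c1 /sup_norm_le1P s1] <-].
by rewrite lee_fin; exact: h.
Qed.

Lemma TV_leP u (t : R) : (TV Omega u <= t%:E)%E <->
  forall phi, C1_c Omega phi ->
    (forall z, Omega z -> eucl_norm (phi z) <= 1) ->
    \int[leb]_(x in Omega) (u x * divergence phi x) <= t.
Proof.
split=> [h phi c1 /sup_norm_le1P s1|h].
  by rewrite -lee_fin; apply: le_trans h; apply: ereal_sup_ubound; exists phi.
apply: ub_ereal_sup => _ [phi [c1 /sup_norm_le1P s1] <-].
by rewrite lee_fin; exact: h.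
Qed.

Lemma divergence_0 (F : 'rV[R]_N -> 'rV[R]_N) x :
  (forall z, F z = 0) -> divergence F x = 0.
Proof.
move=> F0; rewrite /divergence big1// => i _.
rewrite (_ : (fun z => _) = cst 0) ?derive_cst//.
by apply/funext => z; rewrite F0 mxE.
Qed.

Lemma TV_ge0 u : (0 <= TV Omega u)%E.
Proof.
apply: ereal_sup_ubound; exists (cst 0).
  by split; [exact: C1_c_0|exact: sup_norm_0].
congr EFin; under eq_Rintegral do rewrite divergence_0// mulr0.
by rewrite Rintegral_cst// mul0r.
Qed.

Lemma NLTV_ge0 u : (0 <= NLTV Omega w u)%E.
Proof.
apply: ereal_sup_ubound; exists (cst 0).
  by split; [exact: C1_c_0|exact: sup_norm_0].
have d0 x : div_w Omega w (cst 0) x = 0.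
  rewrite /div_w; under eq_Rintegral => y _.
    rewrite divergence_0; last by move=> z; rewrite subrr scaler0.
    over.
  by rewrite Rintegral_cst// mul0r.
congr EFin; under eq_Rintegral do rewrite d0 mulr0.
by rewrite Rintegral_cst// mul0r.
Qed.

Lemma fin_of_lty (t : \bar R) : (0 <= t)%E -> (t < +oo)%E ->
  exists2 r : R, 0 <= r & t = r%:E.
Proof.
move=> t0 toy; exists (fine t); first exact: fine_ge0.
by rewrite fineK// ge0_fin_numE.
Qed.

Lemma L1_normE u : L1 Omega u ->
  L1_norm Omega u = (\int[leb]_(x in Omega) `|u x|)%:E.
Proof.
move=> L1u; rewrite /L1_norm /Rintegral fineK//.
exact: (integrable_fin_num mO (integrable_norm L1u)).
Qed.

Lemma divergence_cutoff (F : 'rV[R]_N -> 'rV[R]_N) : C1_c Omega F ->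
  continuous (divergence F) /\ exists2 C, 0 < C & forall x,
    `|divergence F x| <= C.
Proof.
move=> /(C1_c_cutoffP _ oO) cF; split.
  move=> x; apply: continuous_sumr => i.
  by have [cd _] := cutoff_derive (delta_mx ord0 i) (cF i); exact: cd.
have /choice[C hC] : forall i, exists C, 0 < C /\
    forall x, `|'D_(delta_mx ord0 i) (fun z => F z ord0 i) x| <= C.
  by move=> i; have [C] := cutoff_derive_bounded (delta_mx ord0 i) (cF i);
    exists C.
exists (1 + \sum_i C i).
  by rewrite ltr_pwDl// sumr_ge0// => i _; apply: ltW; have [] := hC i.
move=> x; apply: le_trans (ler_norm_sum _ _ _) _.
by rewrite ler_wpDl// ler_sum// => i _; have [_] := hC i.
Qed.

Lemma L1_mul_integrable u (f : 'rV[R]_N -> R) : L1 Omega u -> continuous f ->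
  (exists2 C, 0 < C & forall x, `|f x| <= C) ->
  leb.-integrable Omega (EFin \o (fun x => u x * f x)).
Proof.
move=> L1u cf [C _ fC].
exact: (bounded_mul_integrable oO L1u (fun x _ => cf x) (fun x _ => fC x)).
Qed.

Lemma cutoff_integrable (f : 'rV[R]_N -> R) : cutoff Omega f ->
  leb.-integrable Omega (EFin \o f).
Proof.
move=> cf; have [C _ fC] := cutoff_bounded cf.
have c := cutoff_continuous cf.
exact: (bounded_integrable oO finO (fun x _ => c x) (fun x _ => fC x)).
Qed.

Lemma cutoff_derive_integrable (f : 'rV[R]_N -> R) v : cutoff Omega f ->
  leb.-integrable Omega (EFin \o 'D_v f).
Proof.
move=> cf; have [C _ fC] := cutoff_derive_bounded v cf.
have [c _] := cutoff_derive v cf.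
exact: (bounded_integrable oO finO (fun x _ => c x) (fun x _ => fC x)).
Qed.

(** Integration by parts: [u * div phi] is the divergence of [u *: phi], which
    has integral zero, minus the scalar product of [phi] and the gradient
    of [u]. *)
Lemma TV_cutoff u : cutoff Omega u ->
  (TV Omega u <= (\int[leb]_(x in Omega) \sum_i `|'D_(delta_mx ord0 i) u
    x|)%:E)%E.
Proof.
move=> cu; apply/TV_leP => phi /[dup] cphi /(C1_c_cutoffP _ oO) cphii phi1.
have [[du _] _] := cu.
pose p i x := phi x ord0 i.
have cup i : cutoff Omega (fun x => u x * p i x).
  exact: (cutoffM oO (C1_on_sub (@subsetT _ Omega) (proj1 cu)) (cphii i)).
have E x : u x * divergence phi x =
    \sum_i ('D_(delta_mx ord0 i) (fun x => u x * p i x) x -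
            p i x * 'D_(delta_mx ord0 i) u x).
  rewrite mulr_sumr; apply: eq_bigr => i _.
  rewrite derive_mul; [|exact: du|by have [[+ _] _] := cphii i; exact].
  by rewrite addrK.
have ip i : leb.-integrable Omega
    (EFin \o (fun x => p i x * 'D_(delta_mx ord0 i) u x)).
  have := @L1_mul_integrable (p i) ('D_(delta_mx ord0 i) u).
  apply; first exact: cutoff_integrable (cphii i).
    by have [] := cutoff_derive (delta_mx ord0 i) cu.
  exact: (cutoff_derive_bounded (delta_mx ord0 i) cu).
have iD i := cutoff_derive_integrable (delta_mx ord0 i) (cup i).
under eq_Rintegral do rewrite E.
rewrite Rintegral_sum//; last by move=> i;
  exact: (integrableB mO (iD i) (ip i)).
have ia i : leb.-integrable Omega (EFin \o
  (fun x => `|'D_(delta_mx ord0 i) u x|)).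
  exact: (integrable_norm (cutoff_derive_integrable (delta_mx ord0 i) cu)).
rewrite Rintegral_sum//; apply: ler_sum => i _.
rewrite RintegralB//.
have [C1up [K [cK KO K0]]] := cup i.
rewrite (Rintegral_partial_eq0 i C1up cK KO K0) sub0r.
apply: le_trans (ler_norm _) _; rewrite normrN.
apply: le_trans (le_normr_Rintegral mO (ip i)) _.
apply: le_Rintegral => //; first exact: (integrable_norm (ip i)).
move=> x Ox; rewrite normrM ler_piMl//.
exact: le_trans (coord_le_eucl _ _) (phi1 x Ox).
Qed.

(** The key reformulation: differentiating under the integral sign, the nonlocal
    divergence of [phi] is the ordinary divergence of the field obtained by
    averaging [w (x, y) *: (phi (y, x) - phi (x, y))] over [y]. *)
Lemma div_w_parametric (phi : 'rV[R]_N * 'rV[R]_N -> 'rV[R]_N)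
    (A : 'I_N -> 'rV[R]_N * 'rV[R]_N -> R) x :
  (forall i z, A i z = w z * (phi (z.2, z.1) ord0 i - phi z ord0 i)) ->
  (forall i, cutoff (Omega `*` Omega) (A i)) ->
  div_w Omega w phi x =
  \sum_i 'D_(delta_mx ord0 i) (fun x => \int[leb]_(y in Omega) A i (x, y)) x.
Proof.
move=> AE cA; rewrite /div_w.
have E y : divergence (fun z => w (z, y) *: (phi (y, z) - phi (z, y))) x =
    \sum_i 'D_(delta_mx ord0 i, 0) (A i) (x, y).
  apply: eq_bigr => i _; have [[dA _] _] := cA i.
  have [_ dE] := derive_comp_diff (delta_mx ord0 i) (is_diff_pairl y x)
    (dA _ I).
  rewrite -dE; apply: (congr1 (fun f => 'D_(delta_mx ord0 i) f x)).
  by apply/funext => z; rewrite !mxE [RHS]AE.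
under eq_Rintegral do rewrite E.
have iA i : leb.-integrable Omega
    (EFin \o (fun y => 'D_(delta_mx ord0 i, 0) (A i) (x, y))).
  have [cd [K [cK _ K0]]] := cutoff_derive (delta_mx ord0 i, 0) (cA i).
  exact: (integrable_section oO finO x cK cd K0).
rewrite Rintegral_sum//; apply: eq_bigr => i _.
have [C1A [K [cK _ K0]]] := cA i.
by have [_ ->] := C1_parametric oO finO C1A cK K0.
Qed.

End variations.

(** * Weights of bounded mass *)

Section embeddings.
Context {R : realType} {N : nat} (Omega : set 'rV[R]_N).
Context (w : 'rV[R]_N * 'rV[R]_N -> R).
Context (oO : open Omega) (finO : (lebesgue_rV N Omega < +oo)%E).
Context (N0 : (0 < N)%N).
Context (hw : admissible_weight Omega w).
Implicit Types u : 'rV[R]_N -> R.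
Local Notation leb := (lebesgue_rV N).
Local Notation vol := (fine (leb Omega)).
Local Notation OO := (Omega `*` Omega).
Let mO := measurable_domain oO.
Let oOO : open OO := openX oO oO.

Lemma weight_continuous_snd x : Omega x ->
  forall y, Omega y -> {for y, continuous (fun y => w (x, y))}.
Proof.
move=> Ox y Oy; have [_ C1w _] := hw.
apply: (@continuous_comp _ _ _ (fun y => (x, y)) w).
  have : differentiable (fun y => (cst x y, id y)) y
    by apply: differentiable_pair.
  exact: differentiable_continuous.
by apply: (C1_on_continuous C1w).
Qed.

(** The averaged field of [div_w_parametric] is an admissible test field for
    [TV] once it is divided by a bound of its norm. Each of its coordinates is
    at most [2 * K], since the coordinates of [phi (y, x) - phi (x, y)] are at
    most 2 and the weight has mass at most [K]. *)
Lemma NLTV_le_TV u (K : R) : 0 < K ->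
  (forall x, Omega x -> (\int[leb]_(y in Omega) (w (x, y))%:E <= K%:E)%E) ->
  BV Omega u -> (NLTV Omega w u <= (2 * K * N%:R)%:E * TV Omega u)%E.
Proof.
move=> K0 hK [L1u TVu]; have [w0 C1w wsym] := hw.
have [t t0 tE] := fin_of_lty (TV_ge0 oO u) TVu.
have tP : (TV Omega u <= t%:E)%E by rewrite tE.
rewrite tE -EFinM; apply/NLTV_leP => phi /(C1_c_cutoffP _ oOO) cphi phi1.
pose a i z := phi (z.2, z.1) ord0 i - phi z ord0 i.
have ca i : cutoff OO (a i).
  rewrite (_ : a i = fun z => phi (z.2, z.1) ord0 i + -1 * phi z ord0 i).
    exact: (cutoffD (cutoff_swap (cphi i)) (cutoffZ (-1) (cphi i))).
  by apply/funext => z; rewrite mulN1r.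
pose A i z := w z * a i z.
have cA i : cutoff OO (A i) by exact: cutoffM.
have a2 i z : OO z -> `|a i z| <= 2.
  move=> [Ox Oy]; apply: le_trans (ler_normB _ _) _.
  have h1 : `|phi (z.2, z.1) ord0 i| <= 1.
    by apply: le_trans (coord_le_eucl _ _) (phi1 _ _).
  have h2 : `|phi z ord0 i| <= 1.
    by apply: le_trans (coord_le_eucl _ _) (phi1 _ _).
  by lra.
pose psi x : 'rV[R]_N := \row_i \int[leb]_(y in Omega) A i (x, y).
have C1psi : C1_c Omega psi.
  apply/(C1_c_cutoffP _ oO) => i; have [C1A [L [cL LU L0]]] := cA i.
  rewrite (_ : (fun x => _) = fun x => \int[leb]_(y in Omega) A i (x, y)).
    split; first by have [] := C1_parametric oO finO C1A cL L0.
    exists (fst @` L); split.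
    - apply: continuous_compact => //; apply: continuous_subspaceT => z.
      exact: cvg_fst.
    - by move=> _ [z /LU[]] ? _ <-.
    - move=> x Lx; under eq_Rintegral => y _.
        rewrite L0; last by move=> Lxy; apply: Lx; exists (x, y).
        over.
      by rewrite Rintegral_cst// mul0r.
  by apply/funext => x; rewrite mxE.
have iw x : Omega x -> leb.-integrable Omega (EFin \o (fun y => w (x, y))).
  move=> Ox; apply/integrableP; split.
    apply/measurable_EFinP; apply: open_continuous_measurable_fun_rV => //.
    exact: weight_continuous_snd.
  apply: le_lt_trans (ltry K); apply: le_trans (hK x Ox).
  rewrite le_eqVlt; apply/orP; left; apply/eqP; apply: eq_integral =>
    y /set_mem Oy.
  by rewrite /= ger0_norm ?w0.
have psiK x i : Omega x -> `|psi x ord0 i| <= 2 * K.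
  move=> Ox; rewrite mxE.
  have [_ [L [cL _ L0]]] := cA i.
  have iA := integrable_section oO finO x cL (cutoff_continuous (cA i)) L0.
  apply: le_trans (le_normr_Rintegral mO iA) _.
  apply: (@le_trans _ _ (\int[leb]_(y in Omega) (2 * w (x, y)))).
    apply: le_Rintegral => //; first exact: (integrable_norm iA).
      exact: (integrableZl mO 2 (iw x Ox)).
    move=> y Oy; rewrite normrM ger0_norm ?w0// mulrC.
    by rewrite ler_wpM2r ?w0// a2.
  rewrite RintegralZl//; last exact: iw.
  rewrite ler_pM2l// -lee_fin /Rintegral fineK; first exact: hK.
  exact: (integrable_fin_num mO (iw x Ox)).
(* The sum of the N coordinate bounds dominates the Euclidean norm. *)
pose c := 2 * K * N%:R.
pose psi' x := c^-1 *: psi x.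
have c0 : 0 < c by rewrite !mulr_gt0// ltr0n.
have C1psi' : C1_c Omega psi'.
  apply/(C1_c_cutoffP _ oO) => i.
  rewrite (_ : (fun x => _) = fun x => c^-1 * psi x ord0 i).
    by apply: cutoffZ; move/(C1_c_cutoffP _ oO) : C1psi; exact.
  by apply/funext => x; rewrite mxE.
have dpsi x : div_w Omega w phi x = c * divergence psi' x.
  rewrite (div_w_parametric oO finO x (A := A))// mulr_sumr.
  apply: eq_bigr => i _.
  have [C1A [L [cL _ L0]]] := cA i.
  have [[dA _] _] := C1_parametric oO finO C1A cL L0.
  rewrite (_ : (fun z => psi' z ord0 i) =
      fun x => c^-1 * \int[leb]_(y in Omega) A i (x, y)).
    by rewrite derive_scale ?mulVKf ?gt_eqF//; exact: dA.
  by apply/funext => z; rewrite !mxE.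
have [cd bd] := divergence_cutoff oO C1psi'.
under eq_Rintegral do rewrite dpsi mulrCA.
rewrite RintegralZl//; last exact: L1_mul_integrable.
rewrite ler_pM2l//; move/TV_leP : tP; apply => // x Ox.
rewrite eucl_normZ gtr0_norm ?invr_gt0// ler_pdivrMl// mulr1.
apply: le_trans (eucl_norm_le _) _.
apply: (@le_trans _ _ (\sum_(i < N) (2 * K))).
  by apply: ler_sum => i _; exact: psiK.
by rewrite sumr_const card_ord /c mulr_natr.
Qed.

End embeddings.

(** * Weights bounded below *)

Section lower_bound.
Context {R : realType} {N : nat} (Omega : set 'rV[R]_N).
Context (w : 'rV[R]_N * 'rV[R]_N -> R).
Context (oO : open Omega) (finO : (lebesgue_rV N Omega < +oo)%E).
Context (hw : admissible_weight Omega w).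
Implicit Types u : 'rV[R]_N -> R.
Local Notation leb := (lebesgue_rV N).
Local Notation vol := (fine (leb Omega)).
Local Notation OO := (Omega `*` Omega).
Let mO := measurable_domain oO.
Let oOO : open OO := openX oO oO.

(** Given a test field [psi] for [TV], take for [phi] the field
    [- k / w (x, y) *: (eta y *: psi x)] with [eta] a fixed bump: it is
    admissible because [k <= w], and the weight cancels in
    [w (x, y) *: (phi (y, x) - phi (x, y))]. The averaged field is then
    [k *: (H *: psi x - eta x *: P)], where [H] and [P] are the integrals of
    [eta] and [psi], so that [u] paired with [div psi] is controlled by [NLTV]
    up to the pairing of [u] with the gradient of [eta], that is, up to a
    multiple of the norm of [u] in [L^1]. *)
Lemma TV_le_NLTV (k : R) : Omega !=set0 -> 0 < k ->
  (forall x y, Omega x -> Omega y -> k <= w (x, y)) ->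
  exists2 C : R, 0 < C & forall u, NLBV Omega w u ->
    (TV Omega u <= C%:E * NLBV_norm Omega w u)%E.
Proof.
move=> [x0 Ox0] k0 kw; have [w0 C1w wsym] := hw.
have [r r0 rO] := open_bump oO Ox0.
pose eta := cube_bump x0 r.
have ceta : cutoff Omega eta by exact: cutoff_cube_bump.
have eta0 x : 0 <= eta x by exact: cube_bump_ge0.
have eta1 x : eta x <= 1 by exact: cube_bump_le1.
have ieta := cutoff_integrable oO finO ceta.
pose H := \int[leb]_(x in Omega) eta x.
have H0 : 0 < H.
  apply: (Rintegral_gt0 oO ieta (fun x _ => eta0 x) _ Ox0).
    exact: (cutoff_continuous ceta).
  by apply: cube_bump_gt0 => //; exact: ballxx.
have /choice[M hM] : forall i, exists C, 0 < C /\
    forall x, `|'D_(delta_mx ord0 i) eta x| <= C.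
  by move=> i; have [C] := cutoff_derive_bounded (delta_mx ord0 i) ceta;
    exists C.
pose D := vol * \sum_i M i.
have D0 : 0 <= D.
  rewrite mulr_ge0 ?vol_ge0// sumr_ge0// => i _; apply: ltW; by have [] := hM i.
(* The first summand multiplies NLTV, the second one the norm in L^1. *)
exists ((k * H)^-1 + H^-1 * D).
  by rewrite ltr_wpDr ?invr_gt0 ?mulr_gt0// mulr_ge0 ?invr_ge0 ?(ltW H0).
move=> u [L1u NLTVu].
have [t t0 tE] := fin_of_lty (NLTV_ge0 w oO u) NLTVu.
have tP : (NLTV Omega w u <= t%:E)%E by rewrite tE.
rewrite /NLBV_norm (L1_normE oO L1u) tE -EFinD -EFinM.
set U := Rintegral _ _ _.
have U0 : 0 <= U by apply: Rintegral_ge0.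
apply/TV_leP => psi /[dup] cpsi /(C1_c_cutoffP _ oO) cpsii psi1.
pose f i (z : 'rV[R]_N * 'rV[R]_N) := psi z.1 ord0 i * eta z.2.
have cf i : cutoff OO (f i) by exact: (cutoffX (cpsii i) ceta).
pose phi (z : 'rV[R]_N * 'rV[R]_N) : 'rV[R]_N :=
  (- k * (w z)^-1 * eta z.2) *: psi z.1.
have wn0 z : OO z -> w z != 0.
  by case: z => x y [/= Ox Oy]; rewrite gt_eqF// (lt_le_trans k0)// kw.
have C1phi : C1_c OO phi.
  apply/(C1_c_cutoffP _ oOO) => i.
  rewrite (_ : (fun x => _) = fun z => - k * ((w z)^-1 * f i z)).
    exact: (cutoffZ (- k) (cutoffM oOO (C1_onV oOO wn0 C1w) (cf i))).
  by apply/funext => z; rewrite mxE /f; lra.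
have phi1 z : OO z -> eucl_norm (phi z) <= 1.
  case: z => x y [/= Ox Oy]; rewrite eucl_normZ !normrM normrN /=.
  have kxy := kw x y Ox Oy.
  have wxy : 0 < w (x, y) by exact: lt_le_trans kxy.
  rewrite (gtr0_norm k0) normfV (gtr0_norm wxy) (ger0_norm (eta0 y)).
  have kw0 : 0 <= k / w (x, y) by rewrite divr_ge0// ltW.
  have kw1 : k / w (x, y) <= 1 by rewrite ler_pdivrMr// mul1r.
  apply: mulr_ile1; [exact: mulr_ge0|exact: eucl_norm_ge0| |exact: psi1].
  exact: mulr_ile1.
pose A i z := k * (f i z - f i (z.2, z.1)).
have AE i z : A i z = w z * (phi (z.2, z.1) ord0 i - phi z ord0 i).
  case: z => x y; rewrite /A /f /phi !mxE /=.
  (* Outside Omega x Omega the weight is arbitrary, but both sides vanish. *)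
  have [[Ox Oy]|nO] := pselect (OO (x, y)).
    rewrite (wsym y x)//; have := wn0 (x, y) (conj Ox Oy).
    move: (w (x, y)) => W W0.
    have WV : W * W^-1 = 1 by rewrite mulfV.
    rewrite -[k in LHS]mulr1 -WV; move: (W^-1) => V; lra.
  have nO' : ~ OO (y, x) by apply: contra_not nO => -[].
  have E2 : psi y ord0 i * eta x = 0 := cutoff_off (x := (y, x)) (cf i) nO'.
  have E1 : psi x ord0 i * eta y = 0 := cutoff_off (x := (x, y)) (cf i) nO.
  transitivity (- k * (w (y, x))^-1 * (psi y ord0 i * eta x) * w (x, y) +
    k * (w (x, y))^-1 * (psi x ord0 i * eta y) * w (x, y)); last by lra.
  by rewrite E1 E2; lra.
have cA i : cutoff OO (A i).
  apply: cutoffZ.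
  rewrite (_ : (fun z => _) = fun z => f i z + -1 * f i (z.2, z.1)).
    exact: (cutoffD (cf i) (cutoffZ (-1) (cutoff_swap (cf i)))).
  by apply/funext => z; rewrite mulN1r.
pose P i := \int[leb]_(y in Omega) psi y ord0 i.
have P1 i : `|P i| <= vol.
  rewrite -[leRHS]mul1r; apply: le_normr_Rintegral_vol => //.
    exact: cutoff_integrable (cpsii i).
  by move=> x Ox; apply: le_trans (coord_le_eucl _ _) (psi1 x Ox).
have psiE i x : \int[leb]_(y in Omega) A i (x, y) =
    k * (H * psi x ord0 i + - P i * eta x).
  have i1 : leb.-integrable Omega (EFin \o (fun y => psi x ord0 i * eta y)).
    exact: (integrableZl mO (psi x ord0 i) ieta).
  have ip := cutoff_integrable oO finO (cpsii i).
  have i2 : leb.-integrable Omega (EFin \o (fun y => psi y ord0 i * eta x)).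
    by have := integrableZr mO (eta x) ip; congr integrable.
  rewrite /A /f/= RintegralZl//; last exact: (integrableB mO i1 i2).
  by rewrite RintegralB// RintegralZl// RintegralZr// mulNr (mulrC H).
pose G x := \sum_i P i * 'D_(delta_mx ord0 i) eta x.
have divE x : div_w Omega w phi x = k * (H * divergence psi x - G x).
  rewrite (div_w_parametric oO finO x AE cA).
  rewrite /divergence /G mulrBr !mulr_sumr -sumrB; apply: eq_bigr => i _.
  have [[dpsi _] _] := cpsii i; have [[deta _] _] := ceta.
  rewrite (_ : (fun x => _) = fun x => k * (H * psi x ord0 i + - P i * eta x)).
    have d1 : differentiable (fun x => H * psi x ord0 i) x.
      by apply: differentiableM; [exact: differentiable_cst|exact: dpsi].
    have d2 : differentiable (fun x => - P i * eta x) x.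
      by apply: differentiableM; [exact: differentiable_cst|exact: deta].
    rewrite derive_scale; last exact: differentiableD.
    rewrite derive_add// !derive_scale; [|exact: deta|exact: dpsi].
    by lra.
  by apply/funext => z; exact: psiE.
have [cdiv bdiv] := divergence_cutoff oO cpsi.
have iD := L1_mul_integrable oO L1u cdiv bdiv.
have iG i : leb.-integrable Omega (EFin \o
  (fun x => u x * 'D_(delta_mx ord0 i) eta x)).
  apply: (L1_mul_integrable oO L1u).
    by have [] := cutoff_derive (delta_mx ord0 i) ceta.
  exact: (cutoff_derive_bounded (delta_mx ord0 i) ceta).
have iPG i : leb.-integrable Omega
    (EFin \o (fun x => P i * (u x * 'D_(delta_mx ord0 i) eta x))).
  exact: (integrableZl mO (P i) (iG i)).
have iS := integrable_Rsum (index_enum 'I_N) mO iPG.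
have intE : \int[leb]_(x in Omega) (u x * div_w Omega w phi x) =
    k * (H * \int[leb]_(x in Omega) (u x * divergence psi x) -
      \sum_i P i * \int[leb]_(x in Omega) (u x * 'D_(delta_mx ord0 i) eta x)).
  have E x : u x * div_w Omega w phi x = k * (H * (u x * divergence psi x) -
      \sum_i P i * (u x * 'D_(delta_mx ord0 i) eta x)).
    have -> : \sum_i P i * (u x * 'D_(delta_mx ord0 i) eta x) = u x * G x.
      by rewrite mulr_sumr; apply: eq_bigr => i _; rewrite mulrCA.
    by rewrite divE; lra.
  under eq_Rintegral do rewrite E.
  have iHD := integrableZl mO H iD.
  rewrite RintegralZl//; last exact: (integrableB mO iHD iS).
  rewrite RintegralB// RintegralZl// Rintegral_sum//.
  by under eq_bigr do rewrite RintegralZl//.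
have := (NLTV_leP _ w u t).1 tP phi C1phi phi1; rewrite intE.
set I := \int[leb]_(x in Omega) (u x * divergence psi x).
set S := \sum_i _ => hI.
have SD : S <= D * U.
  rewrite /S /D mulrAC mulr_sumr; apply: ler_sum => i _.
  apply: le_trans (ler_norm _) _; rewrite normrM -mulrA.
  apply: ler_pM => //; apply: le_trans (le_normr_Rintegral mO (iG i)) _.
  rewrite mulrC -RintegralZl//; last exact: (integrable_norm L1u).
  apply: le_Rintegral => //; first exact: (integrable_norm (iG i)).
    exact: (integrableZl mO (M i) (integrable_norm L1u)).
  move=> x _; rewrite normrM mulrC ler_wpM2r//.
  by have [_] := hM i.
have kH : 0 < k * H by exact: mulr_gt0.
have hI2 : I <= (k * H)^-1 * t + H^-1 * D * U.
  rewrite -(ler_pM2l kH) mulrDr mulrA mulfV ?gt_eqF// mul1r.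
  rewrite (mulrA (k * H)) (mulrA (k * H)) -(mulrA k) mulfV ?gt_eqF// mulr1.
  have := ler_wpM2l (ltW k0) SD; rewrite mulrBr in hI.
  by rewrite -mulrA; lra.
apply: le_trans hI2 _.
have a1 : 0 <= (k * H)^-1 * U by rewrite mulr_ge0// invr_ge0 ltW.
have a2 : 0 <= H^-1 * D * t.
  by apply: mulr_ge0 => //; apply: mulr_ge0; rewrite ?invr_ge0 ?(ltW H0).
by lra.
Qed.

End lower_bound.

(** * Oscillating test functions *)

Section oscillation.
Context {R : realType} {N : nat} (Omega : set 'rV[R]_N).
Context (w : 'rV[R]_N * 'rV[R]_N -> R).
Context (oO : open Omega) (finO : (lebesgue_rV N Omega < +oo)%E).
Context (hw : admissible_weight Omega w).
Implicit Types u : 'rV[R]_N -> R.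
Local Notation leb := (lebesgue_rV N).
Local Notation vol := (fine (leb Omega)).
Local Notation OO := (Omega `*` Omega).
Let mO := measurable_domain oO.
Let oOO : open OO := openX oO oO.

Lemma C1_on_osc (V : normedModType R) (f : V -> R) (S T : R -> R) (l : R) :
  (forall t : R, is_derive t (1 : R) S (l * T t)) -> continuous T ->
  C1_on setT f -> C1_on setT (fun x => S (f x)) /\
  forall v x, 'D_v (fun x => S (f x)) x = l * T (f x) * 'D_v f x.
Proof.
move=> dS cT C1f; have dS1 t : derivable S t 1 by have [] := dS t.
have S'E : derive1 S = fun t => l * T t.
  by apply/funext => t; rewrite derive1E; have [_ ->] := dS t.
split.
  apply: (C1_on_comp_real openT dS1 _ C1f); rewrite S'E => t.
  by apply: cvgM; [exact: cvg_cst|exact: cT].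
move=> v x; have [[df _] cf] := (C1f, I).
by have [_] := derive_comp_real v (dS1 (f x)) (df _ I); rewrite S'E.
Qed.

Lemma C1_weighted_mass (eta : 'rV[R]_N -> R) : cutoff Omega eta ->
  C1_on setT (fun x => \int[leb]_(y in Omega) (w (x, y) * (eta x * eta y))).
Proof.
move=> ceta; have [_ C1w _] := hw.
have [C1A [K [cK _ K0]]] := cutoffM oOO C1w (cutoffX ceta ceta).
by have [] := C1_parametric oO finO C1A cK K0.
Qed.

Lemma cutoff_osc_mass (eta chi : 'rV[R]_N -> R) (S : 'rV[R]_N -> R) :
  cutoff Omega eta -> cutoff Omega chi -> C1_on setT S ->
  cutoff Omega (fun x => chi x * S x ^+ 2 *
    \int[leb]_(y in Omega) (w (x, y) * (eta x * eta y))).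
Proof.
move=> ceta cchi C1S; have C1B := C1_weighted_mass ceta.
have oT : open (setT : set 'rV[R]_N) by exact: openT.
have C1p := C1_onM oT (C1_onM oT C1S C1S) C1B.
have := cutoffM oO (C1_on_sub (@subsetT _ Omega) C1p) cchi.
by congr cutoff; apply/funext => x; rewrite mulrC mulrA.
Qed.

(** The assumed embedding is tested on [S (l * x1) * chi x / l], where [S], [T]
    stand for a sine and a cosine of frequency [l] and [x1] is one coordinate.
    As [l] grows the [L^1] norm of this function tends to zero, while its
    gradient is [T * chi] in the direction of [x1] up to [O(1 / l)], so its [BV]
    norm is at most the integral of [chi] up to [O(1 / l)]. It is paired with
    the field [T * eta x * eta y] in the direction of [x1]: in its nonlocal
    divergence the derivative that falls on [T] gives [l * S] times the averaged
    weight, and all other terms stay bounded as [l] grows. The constant [M]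
    depends neither on the frequency nor on the phase. *)
Lemma oscillation_test (C : R) (eta chi : 'rV[R]_N -> R) (i0 : 'I_N) :
  0 < C ->
  (forall u, BV Omega u -> (NLBV_norm Omega w u <= C%:E * BV_norm Omega u)%E) ->
  cutoff Omega eta -> (forall x, 0 <= eta x <= 1) ->
  cutoff Omega chi -> (forall x, 0 <= chi x) ->
  exists M : R, forall (l : R) (S T : R -> R), 0 < l ->
    (forall t : R, is_derive t (1 : R) S (l * T t)) ->
    (forall t : R, is_derive t (1 : R) T (- l * S t)) ->
    (forall t, `|S t| <= 1) -> (forall t, `|T t| <= 1) ->
    \int[leb]_(x in Omega) (chi x * S (x ord0 i0) ^+ 2 *
      \int[leb]_(y in Omega) (w (x, y) * (eta x * eta y))) <=
    C * \int[leb]_(x in Omega) chi x + M / l.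
Proof.
move=> C0 hC ceta eta01 cchi chi0; have [_ C1w _] := hw.
pose A z := w z * (eta z.1 * eta z.2).
have cA : cutoff OO A by exact: (cutoffM oOO C1w (cutoffX ceta ceta)).
pose e1 : 'rV[R]_N := delta_mx ord0 i0.
have [MA MA0 hMA] := cutoff_derive_bounded (e1, 0) cA.
have [X X0 hX] := cutoff_bounded cchi.
have /choice[Y hY] : forall i, exists C, 0 < C /\
    forall x, `|'D_(delta_mx ord0 i) chi x| <= C.
  by move=> i; have [D] := cutoff_derive_bounded (delta_mx ord0 i) cchi;
    exists D.
pose SY := \sum_i Y i.
pose M := C * (X * vol + SY * vol) + X * (2 * MA * vol) * vol.
exists M => l S T l0 dS dT S1 T1.
have cS : continuous S.
  by move=> t; apply: differentiable_continuous; apply/derivable1_diffP;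
    have [] := dS t.
have cT : continuous T.
  by move=> t; apply: differentiable_continuous; apply/derivable1_diffP;
    have [] := dT t.
pose x1 (x : 'rV[R]_N) := x ord0 i0.
have C1x1 : C1_on setT x1 by apply: C1_on_coord; exact: openT.
have [C1S dSE] := C1_on_osc dS cT C1x1.
have [C1T dTE] := C1_on_osc dT cS C1x1.
pose u x := l^-1 * (S (x1 x) * chi x).
have cu : cutoff Omega u.
  exact: (cutoffZ l^-1 (cutoffM oO (C1_on_sub (@subsetT _ Omega) C1S) cchi)).
have iu := cutoff_integrable oO finO cu.
have ichi := cutoff_integrable oO finO cchi.
have du i x : 'D_(delta_mx ord0 i) u x =
    (i == i0)%:R * (T (x1 x) * chi x) + l^-1 *
      (S (x1 x) * 'D_(delta_mx ord0 i) chi x).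
  have [[d1 _] [[d2 _] _]] := (C1S, cchi).
  have dd : differentiable (fun x => S (x1 x) * chi x) x.
    by apply: differentiableM; [exact: d1|exact: d2].
  rewrite derive_scale// derive_mul; [|exact: d1|exact: d2].
  rewrite dSE /x1 derive_coord mxE eqxx /= (eq_sym i0 i).
  have ll : l^-1 * l = 1 by rewrite mulVf// gt_eqF.
  rewrite -[X in _ = X + _]mul1r -ll.
  by move: (l^-1) => v; lra.
have l1 : 0 < l^-1 by rewrite invr_gt0.
have ubound x : `|u x| <= l^-1 * X.
  rewrite normrM (gtr0_norm l1) ler_wpM2l ?(ltW l1)// normrM.
  by rewrite -[X]mul1r ler_pM.
have dubound x : \sum_i `|'D_(delta_mx ord0 i) u x| <= chi x + l^-1 * SY.
  apply: (@le_trans _ _ (\sum_(i < N) ((i == i0)%:R * chi x + l^-1 * Y i))).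
    apply: ler_sum => i _; rewrite du; apply: le_trans (ler_normD _ _) _.
    apply: lerD.
      rewrite normrM normr_nat ler_wpM2l// normrM (ger0_norm (chi0 x)).
      by rewrite ler_piMl.
    rewrite normrM (gtr0_norm l1) ler_wpM2l ?(ltW l1)// normrM.
    by rewrite -[Y i]mul1r ler_pM//; have [_] := hY i.
  rewrite big_split/= -mulr_sumr lerD2r (bigD1 i0)//= eqxx mul1r big1 ?addr0//.
  by move=> i /negPf->; rewrite mul0r.
have L1u : (L1_norm Omega u <= (l^-1 * X * vol)%:E)%E.
  rewrite (L1_normE oO iu) lee_fin; apply: le_trans (ler_norm _) _.
  apply: le_normr_Rintegral_vol => //; first exact: (integrable_norm iu).
  by move=> x _; rewrite normr_id.
have icst (c : R) : leb.-integrable Omega (EFin \o (fun _ => c)).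
  apply: (bounded_integrable oO finO (C := `|c|)) => // x _;
    exact: cst_continuous.
have TVu : (TV Omega u <= (\int[leb]_(x in Omega) chi x + l^-1 * SY *
  vol)%:E)%E.
  apply: le_trans (TV_cutoff oO finO cu) _; rewrite lee_fin.
  rewrite -(Rintegral_cst leb mO) -RintegralD//.
  apply: le_Rintegral => //.
    apply: integrable_Rsum => // i.
    exact: (integrable_norm (cutoff_derive_integrable oO finO (delta_mx ord0 i)
      cu)).
  exact: (integrableD mO ichi (icst _)).
have BVu : BV Omega u by split=> //; exact: le_lt_trans TVu (ltry _).
pose b := C * (l^-1 * X * vol + (\int[leb]_(x in Omega) chi x + l^-1 * SY *
  vol)).
have NLTVu : (NLTV Omega w u <= b%:E)%E.
  apply: (@le_trans _ _ (NLBV_norm Omega w u)).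
    by rewrite /NLBV_norm leeDr// (L1_normE oO iu) lee_fin;
      apply: Rintegral_ge0.
  apply: le_trans (hC u BVu) _.
  rewrite EFinM EFinD; apply: lee_wpmul2l; first by rewrite lee_fin ltW.
  exact: leeD.
pose phi (z : 'rV[R]_N * 'rV[R]_N) : 'rV[R]_N :=
  (T (x1 z.1) * (eta z.1 * eta z.2)) *: e1.
have C1phi : C1_c OO phi.
  apply/(C1_c_cutoffP _ oOO) => i.
  rewrite (_ : (fun x => _) = fun z => (i == i0)%:R *
      (T (x1 z.1) * (eta z.1 * eta z.2))).
    exact: (cutoffZ _ (cutoffM oOO (C1_on_sub (@subsetT _ OO) (C1_on_fst _ C1T))
      (cutoffX ceta ceta))).
  by apply/funext => z; rewrite !mxE eqxx eq_sym /= mulrC eq_sym.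
have phi1 z : OO z -> eucl_norm (phi z) <= 1.
  move=> _; rewrite eucl_norm_delta !normrM.
  have e01 x : 0 <= `|eta x| <= 1.
    by have /andP[a1 a2] := eta01 x; rewrite ger0_norm// a1.
  have /andP[a1 a2] := e01 z.1; have /andP[a3 a4] := e01 z.2.
  by apply: mulr_ile1 => //; exact: mulr_ile1.
have hphi := (NLTV_leP _ w u b).1 NLTVu phi C1phi phi1.
pose G z := (T (x1 z.2) + -1 * T (x1 z.1)) * A z.
have C1d : C1_on setT (fun z : 'rV[R]_N * 'rV[R]_N =>
  T (x1 z.2) + -1 * T (x1 z.1)).
  have oT : open (setT : set ('rV[R]_N * 'rV[R]_N)) by exact: openT.
  have h1 := C1_on_snd 'rV[R]_N C1T.
  have h2 := C1_on_fst 'rV[R]_N C1T.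
  have h3 := C1_onM oT (C1_on_cst _ (- 1 : R)) h2.
  exact: (C1_onD oT h1 h3).
have cG : cutoff OO G.
  exact: (cutoffM oOO (C1_on_sub (@subsetT _ OO) C1d) cA).
pose F (i : 'I_N) z := (i == i0)%:R * G z.
have FE i z : F i z = w z * (phi (z.2, z.1) ord0 i - phi z ord0 i).
  rewrite /F /G /A /phi !mxE eqxx eq_sym /=.
  by move: (i0 == i)%:R => d; lra.
have cF i : cutoff OO (F i) by exact: cutoffZ.
have dG x y : 'D_(e1, 0) G (x, y) =
    (T (x1 y) - T (x1 x)) * 'D_(e1, 0) A (x, y) + l * S (x1 x) * A (x, y).
  have [[dd _] [[dA _] _]] := (C1d, cA); have [dT1 _] := C1T.
  have [d1 d1E] := derive_comp_diff (e1, 0 : 'rV[R]_N) (is_diff_snd (x, y))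
    (dT1 _ I).
  have [d2 d2E] := derive_comp_diff (e1, 0 : 'rV[R]_N) (is_diff_fst (x, y))
    (dT1 _ I).
  have d3 : differentiable (fun z : 'rV[R]_N * 'rV[R]_N => -1 * T (x1 z.1))
    (x, y).
    by apply: differentiableM; [exact: differentiable_cst|exact: d2].
  rewrite derive_mul; [|exact: dd|exact: dA].
  rewrite derive_add; [|exact: d1|exact: d3].
  rewrite derive_scale; last exact: d2.
  rewrite [X in _ + _ * (X + _)]d1E [X in _ + _ * (_ + _ * X)]d2E /= derive0.
  rewrite dTE /x1 derive_coord mxE !eqxx /=; lra.
have iA x : leb.-integrable Omega (EFin \o (fun y => A (x, y))).
  have [_ [K [cK _ K0]]] := cA.
  exact: (integrable_section oO finO x cK (cutoff_continuous cA) K0).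
have iDG x : leb.-integrable Omega (EFin \o (fun y => 'D_(e1, 0) G (x, y))).
  have [cd [K [cK _ K0]]] := cutoff_derive (e1, 0) cG.
  exact: (integrable_section oO finO x cK cd K0).
pose B x := \int[leb]_(y in Omega) A (x, y).
have divE x : div_w Omega w phi x = \int[leb]_(y in Omega) 'D_(e1, 0) G (x, y).
  rewrite (div_w_parametric oO finO x FE cF) (bigD1 i0)//= big1 => [|i ii0].
    rewrite addr0 /F eqxx; under eq_fun do under eq_Rintegral do rewrite mul1r.
    have [C1G [K [cK _ K0]]] := cG.
    by have [_ ->] := C1_parametric oO finO C1G cK K0.
  rewrite (_ : (fun x => _) = cst 0) ?derive_cst//; apply/funext => z.
  rewrite /F (negPf ii0); under eq_Rintegral do rewrite mul0r.
  by rewrite Rintegral_cst// mul0r.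
have divB x : `|div_w Omega w phi x - l * S (x1 x) * B x| <= 2 * MA * vol.
  rewrite divE -RintegralZl// -RintegralB//; last first.
    exact: (integrableZl mO (l * S (x1 x)) (iA x)).
  apply: le_normr_Rintegral_vol => //.
    exact: (integrableB mO (iDG x) (integrableZl mO (l * S (x1 x)) (iA x))).
  move=> y _; rewrite dG addrK normrM ler_pM//.
  apply: le_trans (ler_normB _ _) _.
  by have := T1 (x1 y); have := T1 (x1 x); lra.
have [cdiv [K [cK _ K0]]] := cutoff_derive (e1, 0) cG.
have cD : continuous (div_w Omega w phi).
  rewrite (_ : div_w _ _ _ = fun x => \int[leb]_(y in Omega) 'D_(e1, 0) G
    (x, y)).
    exact: (continuous_parametric oO finO cK cdiv K0).
  by apply/funext => x; exact: divE.
have [Z Z0 hZ] := cutoff_derive_bounded (e1, 0) cG.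
have bD : exists2 D, 0 < D & forall x, `|div_w Omega w phi x| <= D.
  exists (Z * vol + 1) => [|x].
    by rewrite ltr_wpDl// mulr_ge0 ?(ltW Z0)// vol_ge0.
  rewrite divE; apply: le_trans (_ : Z * vol <= _); last by rewrite lerDl.
  by apply: le_normr_Rintegral_vol.
have iud := L1_mul_integrable oO iu cD bD.
have ikey : leb.-integrable Omega
    (EFin \o (fun x => chi x * S (x1 x) ^+ 2 * B x)).
  exact: (cutoff_integrable oO finO (cutoff_osc_mass ceta cchi C1S)).
(* E bounds the part of u * div_w phi in which no derivative falls on T. *)
pose E := l^-1 * (X * (2 * MA * vol)).
apply: (@le_trans _ _ (\int[leb]_(x in Omega) (u x * div_w Omega w phi x) + E *
  vol)).
  rewrite -(Rintegral_cst leb mO) -RintegralD//.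
  apply: le_Rintegral => //; first exact: (integrableD mO iud (icst E)).
  move=> x _; rewrite -[leLHS]/(chi x * S (x1 x) ^+ 2 * B x).
  set d := div_w _ _ _ _.
  have -> : chi x * S (x1 x) ^+ 2 * B x =
      u x * d - l^-1 * ((S (x1 x) * chi x) * (d - l * S (x1 x) * B x)).
    have ll : l^-1 * l = 1 by rewrite mulVf// gt_eqF.
    rewrite -[LHS]mul1r -ll /u; move: (l^-1) => v; lra.
  rewrite lerD2l; apply: le_trans (ler_norm _) _.
  rewrite normrN normrM (gtr0_norm l1) ler_wpM2l ?(ltW l1)// normrM.
  apply: ler_pM => //; last exact: divB.
  by rewrite normrM -[X]mul1r ler_pM.
apply: le_trans (lerD hphi (lexx (E * vol))) _.
rewrite /b /E /M; move: (l^-1) => v.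
set I1 := Rintegral _ _ _.
lra.
Qed.

End oscillation.

(** * The embedding forces a bound on the mass of the weight *)

Section necessity.
Context {R : realType} {N : nat} (Omega : set 'rV[R]_N).
Context (w : 'rV[R]_N * 'rV[R]_N -> R).
Context (oO : open Omega) (finO : (lebesgue_rV N Omega < +oo)%E).
Context (N0 : (0 < N)%N).
Context (hw : admissible_weight Omega w).
Implicit Types u : 'rV[R]_N -> R.
Local Notation leb := (lebesgue_rV N).
Local Notation vol := (fine (leb Omega)).
Local Notation OO := (Omega `*` Omega).
Let mO := measurable_domain oO.
Let oOO : open OO := openX oO oO.

Lemma is_derive_comp_scale (h : R -> R) (h' l t : R) :
  is_derive (l * t) (1 : R) h h' ->
  is_derive t (1 : R) (fun t => h (l * t)) (l * h').
Proof.
move=> [dh h'E]; have [dl dlE] := is_diff_scaler l t.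
have [d dE] := derive_comp_real (1 : R) dh dl.
apply: DeriveDef; first exact: diff_derivable.
rewrite [LHS]dE derive1E h'E deriveE// dlE mulrC; congr (_ * _).
exact: mulr1.
Qed.

Context (C : R) (C0 : 0 < C).
Context (hC : forall u, BV Omega u ->
  (NLBV_norm Omega w u <= C%:E * BV_norm Omega u)%E).

(** Add [oscillation_test] for a sine and for a cosine, so that the squares add
    up to [1], and let the frequency tend to infinity. *)
Lemma mean_mass_bound (eta chi : 'rV[R]_N -> R) :
  cutoff Omega eta -> (forall x, 0 <= eta x <= 1) ->
  cutoff Omega chi -> (forall x, 0 <= chi x) ->
  \int[leb]_(x in Omega) (chi x *
    \int[leb]_(y in Omega) (w (x, y) * (eta x * eta y))) <=
  2 * C * \int[leb]_(x in Omega) chi x.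
Proof.
move=> ceta eta01 cchi chi0; pose i0 := Ordinal N0.
have [M hM] := oscillation_test oO finO hw i0 C0 hC ceta eta01 cchi chi0.
set B := fun x => \int[leb]_(y in Omega) (w (x, y) * (eta x * eta y)).
set I := \int[leb]_(x in Omega) chi x.
have step (l : R) : 0 < l ->
    \int[leb]_(x in Omega) (chi x * B x) <= 2 * C * I + 2 * M / l.
  move=> l0.
  have dcosN t : is_derive t (1 : R) (fun t => - sin (l * t))
    (- l * cos (l * t)).
    have [d dE] := is_deriveN (is_derive_comp_scale (is_derive_sin (l * t))).
    by apply: DeriveDef => //; rewrite [LHS]dE mulNr.
  have dcos t : is_derive t (1 : R) (fun t => cos (l * t)) (- l * sin (l * t)).
    have [d dE] := is_derive_comp_scale (is_derive_cos (l * t)).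
    by apply: DeriveDef => //; rewrite [LHS]dE mulrN mulNr.
  have h1 := hM l _ _ l0 (fun t => is_derive_comp_scale (is_derive_sin (l * t)))
    dcos
    (fun t => sin_max _) (fun t => cos_max _).
  have h2 := hM l _ (fun t => - sin (l * t)) l0
    (fun t => is_derive_comp_scale (is_derive_cos (l * t))) dcosN
    (fun t => cos_max _) (fun t => ltac:(rewrite normrN; exact: sin_max)).
  have C1x : C1_on setT (fun x : 'rV[R]_N => x ord0 i0).
    by apply: C1_on_coord; exact: openT.
  have csin : continuous (fun t : R => sin (l * t)).
    move=> t; apply: differentiable_continuous; apply/derivable1_diffP.
    by have [] := is_derive_comp_scale (is_derive_sin (l * t)).
  have ccos : continuous (fun t : R => cos (l * t)).
    move=> t; apply: differentiable_continuous; apply/derivable1_diffP.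
    by have [] := is_derive_comp_scale (is_derive_cos (l * t)).
  have cNsin : continuous (fun t : R => - sin (l * t)).
    by move=> t; apply: cvgN; exact: csin.
  have [C1s _] := C1_on_osc (fun t => is_derive_comp_scale
    (is_derive_sin (l * t))) ccos C1x.
  have [C1c _] := C1_on_osc (fun t => is_derive_comp_scale
    (is_derive_cos (l * t))) cNsin C1x.
  have is_ := cutoff_integrable oO finO (cutoff_osc_mass oO finO hw ceta cchi
    C1s).
  have ic := cutoff_integrable oO finO (cutoff_osc_mass oO finO hw ceta cchi
    C1c).
  have := lerD h1 h2; rewrite -RintegralD//.
  under eq_Rintegral => x _.
    rewrite -mulrDl -mulrDr addrC cos2Dsin2 mulr1.
    over.
  by move=> /le_trans; apply; rewrite /I; lra.
apply/ler_addgt0Pr => e e0.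
have M0 : 0 < 2 * `|M| + 1 by rewrite ltr_wpDl// mulr_ge0.
have := step ((2 * `|M| + 1) / e); rewrite divr_gt0// => /(_ isT).
move=> /le_trans; apply; rewrite lerD2l invf_div mulrA ler_pdivrMr//.
rewrite mulrC ler_wpM2l ?(ltW e0)//.
by have := ler_norm M; lra.
Qed.

(** A continuous function whose mean against every bump is at most [2 * C] is at
    most [2 * C]; it suffices to take a bump around a point where this fails. *)
Lemma mass_bound (eta : 'rV[R]_N -> R) (x0 : 'rV[R]_N) :
  cutoff Omega eta -> (forall x, 0 <= eta x <= 1) -> Omega x0 ->
  \int[leb]_(y in Omega) (w (x0, y) * (eta x0 * eta y)) <= 2 * C.
Proof.
move=> ceta eta01 Ox0.
set B := fun x => \int[leb]_(y in Omega) (w (x, y) * (eta x * eta y)).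
rewrite leNgt; apply/negP => Bx0.
have C1B : C1_on setT B by exact: C1_weighted_mass.
pose c := (2 * C + B x0) / 2.
have cB : c < B x0 by rewrite /c ltr_pdivrMr//; move: Bx0; rewrite -/(B x0);
  lra.
have Cc : 2 * C < c by rewrite /c ltr_pdivlMr//; move: Bx0; rewrite -/(B x0);
  lra.
have : \forall x \near x0, Omega x /\ c < B x.
  have h1 : \forall x \near x0, Omega x by exact: open_nbhs_nbhs.
  have h2 : \forall x \near x0, c < B x.
    by apply: (cvgr_gt _ (C1_on_continuous C1B (I : setT x0))).
  by apply: filterS2 h1 h2.
move=> /nbhs_ballP[d /= d0 dO].
have d20 : 0 < d / 2 by rewrite divr_gt0.
have QO x : cube x0 (d / 2) x -> Omega x /\ c < B x.
  by move=> h; apply: dO; apply: cube_sub_ball h => //; lra.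
pose chi := cube_bump x0 (d / 2).
have cchi : cutoff Omega chi by apply: cutoff_cube_bump => // x /QO[].
have chi0 x : 0 <= chi x by exact: cube_bump_ge0.
have ichi := cutoff_integrable oO finO cchi.
have Ichi : 0 < \int[leb]_(x in Omega) chi x.
  apply: (Rintegral_gt0 oO ichi (fun x _ => chi0 x) _ Ox0).
    exact: (cutoff_continuous cchi).
  by apply: cube_bump_gt0 => //; exact: ballxx.
have := mean_mass_bound ceta eta01 cchi chi0; rewrite -/B leNgt => /negP; apply.
apply: (@lt_le_trans _ _ (c * \int[leb]_(x in Omega) chi x)).
  by rewrite ltr_pM2r.
rewrite -RintegralZl//; apply: le_Rintegral => //.
- exact: (integrableZl mO c ichi).
- have := cutoff_integrable oO finO (cutoffM oO
  (C1_on_sub (@subsetT _ Omega) C1B) cchi).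
  by congr integrable; apply/funext => x /=; rewrite mulrC.
- move=> x Ox; have [/QO[_ /ltW cBx]|nQ] := pselect (cube x0 (d / 2) x).
    by rewrite mulrC ler_wpM2l.
  by rewrite /chi (cube_bump_off_cube d20 nQ) mulr0 mul0r.
Qed.

(** Fatou along an exhaustion of [Omega] by the cutoffs [eta]. *)
Lemma weight_mass_bound (x0 : 'rV[R]_N) : Omega x0 ->
  (\int[leb]_(y in Omega) (w (x0, y))%:E <= (2 * C)%:E)%E.
Proof.
move=> Ox0; have [w0 C1w _] := hw.
have [eta [ceta [eta01 eta1]]] := open_exhaustion oO.
pose f n y := (w (x0, y) * (eta n x0 * eta n y))%:E.
have f0 n y : Omega y -> (0 <= f n y)%E.
  move=> Oy; rewrite lee_fin mulr_ge0 ?w0//.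
  by have /andP[a1 _] := eta01 n x0; have /andP[a2 _] := eta01 n y;
    exact: mulr_ge0.
have cA n := cutoffM oOO C1w (cutoffX (ceta n) (ceta n)).
have iA n : leb.-integrable Omega (f n).
  have [_ [K [cK _ K0]]] := cA n.
  exact: (integrable_section oO finO x0 cK (cutoff_continuous (cA n)) K0).
have mf n : measurable_fun Omega (f n) := measurable_int _ (iA n).
have := fatou leb mO mf f0.
rewrite [X in (X <= _)%E -> _](_ : _ = (\int[leb]_(y in Omega)
  (w (x0, y))%:E)%E).
  move=> /le_trans; apply; rewrite limn_einf_lim; apply: lime_le.
    exact: is_cvg_einfs.
  apply: nearW => n; apply: (@le_trans _ _ (\int[leb]_(y in Omega) f n y)%E).
    by apply: ereal_inf_lbound; exists n => /=.
  rewrite -[leLHS]fineK; last exact: (integrable_fin_num mO (iA n)).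
  by rewrite lee_fin; exact: mass_bound.
apply: eq_integral => y /set_mem Oy.
suff : f n y @[n --> \oo] --> (w (x0, y))%:E by move=> /cvg_limn_einf_sup[-> _].
apply: cvg_EFin; first exact: nearW.
have ee : eta n x0 * eta n y @[n --> \oo] --> (1 * 1 : R).
  by apply: cvgM; exact: eta1.
have : w (x0, y) * (eta n x0 * eta n y) @[n --> \oo] --> w (x0, y) * (1 * 1).
  by apply: cvgM => //; exact: cvg_cst.
by rewrite !mulr1.
Qed.

End necessity.

(** * The embedding theorem *)

Theorem theorem1p1 (R : realType) (N : nat) (hN : (0 < N)%N)
    (Omega : set 'rV[R]_N) (w : 'rV[R]_N * 'rV[R]_N -> R)
    (hOmega0 : Omega !=set0) (hOmega_open : open Omega)
    (hOmega_fin : (lebesgue_rV N Omega < +oo)%E)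
    (hw : admissible_weight Omega w) :
  ((exists2 k : R, 0 < k &
      forall x y, Omega x -> Omega y -> k <= w (x, y)) ->
    embeds (NLBV Omega w) (NLBV_norm Omega w) (BV Omega) (BV_norm Omega)) /\
  (embeds (BV Omega) (BV_norm Omega) (NLBV Omega w) (NLBV_norm Omega w) <->
    exists2 K : R, 0 < K &
      forall x, Omega x ->
        (\int[lebesgue_rV N]_(y in Omega) (w (x, y))%:E <= K%:E)%E).
Proof.
have L10 u : (0 <= L1_norm Omega u)%E by apply: integral_ge0.
split; last split.
- move=> [k k0 kw].
  have [C C0 hC] := TV_le_NLTV hOmega_open hOmega_fin hw hOmega0 k0 kw.
  have hB u : NLBV Omega w u -> (BV_norm Omega u <= (1 + C)%:E * NLBV_norm Omega
    w u)%E.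
    move=> hu; rewrite /BV_norm EFinD ge0_muleDl//; last by rewrite lee_fin ltW.
    rewrite mul1e; apply: leeD; last exact: hC.
    by rewrite /NLBV_norm leeDl// NLTV_ge0.
  split; last by exists (1 + C); [rewrite ltr_wpDl|exact: hB].
  move=> u /[dup] hu [L1u NLu]; split=> //.
  apply: le_lt_trans (hC u hu) _; rewrite /NLBV_norm (L1_normE hOmega_open L1u).
  have [t t0 ->] := fin_of_lty (NLTV_ge0 w hOmega_open u) NLu.
  by rewrite -EFinD -EFinM ltry.
- move=> [sub [C C0 hC]]; exists (2 * C); first by rewrite mulr_gt0.
  by move=> x Ox; exact: weight_mass_bound hC _ Ox.
- move=> [K K0 hK].
  have hT u : BV Omega u -> (NLTV Omega w u <= (2 * K * N%:R)%:E * TV Omega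
    u)%E.
    exact: NLTV_le_TV.
  have c0 : 0 < 2 * K * N%:R by rewrite !mulr_gt0 ?ltr0n.
  split=> [u /[dup] hu [L1u TVu]|].
    split=> //; apply: le_lt_trans (hT u hu) _.
    have [t t0 ->] := fin_of_lty (TV_ge0 hOmega_open u) TVu.
    by rewrite -EFinM ltry.
  exists (1 + 2 * K * N%:R) => [|u hu]; first by rewrite addr_gt0.
  rewrite /NLBV_norm /BV_norm EFinD ge0_muleDl//; last by rewrite lee_fin ltW.
  rewrite mul1e; apply: leeD; first by rewrite leeDl// TV_ge0.
  apply: le_trans (hT u hu) _; apply: lee_wpmul2l; first by rewrite lee_fin ltW.
  by rewrite leeDr.
Qed.
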